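(* Let $G_m$ be a bounded Vilenkin group, let $f\in L_1(G_m)$, and let $T_n$ be the $T$ means associated with a non-decreasing sequence $\{q_k:k\ge 0\}$ of non-negative numbers with $q_0>0$ satisfying $$\frac{q_{n-1}}{Q_n}=O\left(\frac1n\right)\quad(n\to\infty).$$ Then $$T_nf\to f\quad\text{a.e., as } n\to\infty .$$
   Context: Notation: $\mathbb N_+=\{1,2,\dots\}$, $\mathbb N=\mathbb N_+\cup\{0\}$. Let $m=(m_0,m_1,\dots)$ be a sequence of integers $m_k\ge 2$ with $\sup_k m_k<\infty$ (bounded case). $Z_{m_k}=\{0,\dots,m_k-1\}$ is the additive group of integers modulo $m_k$ with the discrete topology, and $G_m=\prod_{k\ge 0}Z_{m_k}$ with the product topology and the product measure $\mu$ of the uniform measures $\mu_k(\{j\})=1/m_k$ (normalized Haar measure). Elements are $x=(x_0,x_1,\dots)$ with $x_j\in Z_{m_j}$. Put $M_0=1$, $M_{k+1}=m_kM_k$; each $n\in\mathbb N$ is uniquely $n=\sum_{j\ge 0}n_jM_j$ with $n_j\in Z_{m_j}$, finitely many nonzero. Generalized Rademacher functions: $r_k(x)=\exp(2\pi i x_k/m_k)$. Vilenkin system: $\psi_n(x)=\prod_{k\ge 0}r_k^{n_k}(x)$, $n\in\mathbb N$. For $f\in L_1(G_m)$: $\widehat f(n)=\int_{G_m}f\overline{\psi}_n\,d\mu$, and $S_nf=\sum_{k=0}^{n-1}\widehat f(k)\psi_k$ for $n\in\mathbb N_+$, with $S_0f=0$. Given the sequence $\{q_k\}$, put $Q_n=\sum_{k=0}^{n-1}q_k$.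 The $T$ means are $T_nf=\frac1{Q_n}\sum_{k=0}^{n-1}q_kS_kf$, $n\in\mathbb N_+$. *)

(* Defs.v *)
From HB Require Import structures.
From mathcomp Require Import all_boot all_order all_algebra.
From mathcomp Require Import all_classical all_reals all_analysis.

From mathcomp Require Import complex zify.

Set Implicit Arguments.
Unset Strict Implicit.
Unset Printing Implicit Defensive.

Import Order.TTheory GRing.Theory Num.Theory.
Import numFieldNormedType.Exports.

Local Open Scope classical_set_scope.
Local Open Scope ring_scope.
Local Open Scope complex_scope.

(* 'Z_p is the ring of integers modulo p only when 1 < p; results about
   vilenkin m therefore assume 1 < m k for every k. *)
Definition vilenkin (m : nat -> nat) : Type := forall k : nat, 'Z_(m k).

Section vilenkin_measurable.
Variable m : nat -> nat.

(* Every subset of the discrete group 'Z_(m k) is measurable. *)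
Definition vilenkin_cylinder : set (set (vilenkin m)) :=
  [set B | exists k (A : set 'Z_(m k)), B = [set x | A (x k)]].

HB.instance Definition _ := gen_eqMixin (vilenkin m).
HB.instance Definition _ := gen_choiceMixin (vilenkin m).
HB.instance Definition _ := isPointed.Build (vilenkin m) (fun=> 0).

Definition vilenkin_display : measure_display.
Proof. by constructor. Qed.

(* The product sigma-algebra; it is also the Borel sigma-algebra of the
   product topology, since the factors are finite and countably many. *)
Definition vilenkin_measurable : set (set (vilenkin m)) :=
  <<s vilenkin_cylinder >>.

Let vilenkin_measurable0 : vilenkin_measurable set0.
Proof. exact: sigma_algebra0. Qed.

Let vilenkin_measurableC A :
  vilenkin_measurable A -> vilenkin_measurable (~` A).
Proof. exact: sigma_algebraC. Qed.

Let vilenkin_measurable_bigcup (F : (set (vilenkin m))^nat) :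
  (forall i, vilenkin_measurable (F i)) ->
  vilenkin_measurable (\bigcup_i F i).
Proof. exact: sigma_algebra_bigcup. Qed.

HB.instance Definition _ := @isMeasurable.Build vilenkin_display
  (vilenkin m) vilenkin_measurable
  vilenkin_measurable0 vilenkin_measurableC vilenkin_measurable_bigcup.

End vilenkin_measurable.

Section vilenkin_fourier.
Variables (R : realType) (m : nat -> nat).

(* The uniform measure of A is #|A| / m_k; finite rectangles determine the
   product measure. *)
Definition is_product_measure
    (mu : {measure set (vilenkin m) -> \bar R}) : Prop :=
  forall (n : nat) (A : forall k : nat, {set 'Z_(m k)}),
    mu [set x | forall k, (k < n)%N -> x k \in A k] =
    (\prod_(k < n) (#|A k|%:R / (m k)%:R))%:E.

Definition vM (n : nat) : nat := (\prod_(k < n) m k)%N.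

Definition vdigit (n j : nat) : nat := (n %/ vM j %% m j)%N.

Lemma vdigit_lt n j : (0 < m j)%N -> (vdigit n j < m j)%N.
Proof. by move=> mj; rewrite ltn_mod. Qed.

Lemma vM_gt n : (forall k, 1 < m k)%N -> (n < vM n)%N.
Proof.
move=> m1; elim: n => [|n IH]; first by rewrite /vM big_ord0.
rewrite /vM big_ord_recr /= -/(vM n).
by apply: (@leq_trans (vM n * 2)%N); [lia|rewrite leq_mul2l m1 orbT].
Qed.

Lemma vdigit_eq0 n j : (forall k, 1 < m k)%N -> (n <= j)%N -> vdigit n j = 0%N.
Proof.
move=> m1 nj; rewrite /vdigit divn_small ?mod0n//.
exact: leq_ltn_trans nj (vM_gt j m1).
Qed.

Lemma vdigit_sum n : (forall k, 1 < m k)%N ->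
  n = (\sum_(j < n) vdigit n j * vM j)%N.
Proof.
move=> m1.
have H N : (n %% vM N = \sum_(j < N) vdigit n j * vM j)%N.
  elim: N => [|N IH]; first by rewrite /vM !big_ord0 modn1.
  rewrite big_ord_recr /= -IH /vdigit {1}/vM big_ord_recr /= -/(vM N).
  have VN : (0 < vM N)%N by exact: leq_trans (vM_gt N m1).
  have mN : (0 < m N)%N by exact: ltnW (m1 N).
  rewrite modn_divl {1}(divn_eq (n %% (vM N * m N)) (vM N)).
  by rewrite addnC modn_dvdm ?dvdn_mulr// [(vM N * m N)%N]mulnC.
by rewrite -H modn_small// vM_gt.
Qed.

Definition rademacher (k : nat) (x : vilenkin m) : R[i] :=
  let t := 2 * pi * (x k : nat)%:R / (m k)%:R in cos t +i* sin t.

(* By vdigit_eq0 the factors of index k >= n are 1. *)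
Definition vilenkin_psi (n : nat) (x : vilenkin m) : R[i] :=
  \prod_(k < n) rademacher k x ^+ vdigit n k.

Variable mu : {measure set (vilenkin m) -> \bar R}.

Definition complex_L1 (f : vilenkin m -> R[i]) : Prop :=
  [/\ measurable_fun setT (fun x => complex.Re (f x)),
      measurable_fun setT (fun x => complex.Im (f x)) &
      (\int[mu]_x (Normc.normc (f x))%:E < +oo)%E].

Definition complex_integral (g : vilenkin m -> R[i]) : R[i] :=
  (\int[mu]_x complex.Re (g x)) +i* (\int[mu]_x complex.Im (g x)).

Definition fourier_coef (f : vilenkin m -> R[i]) (n : nat) : R[i] :=
  complex_integral (fun x => f x * (vilenkin_psi n x)^*).

Definition partial_sum (f : vilenkin m -> R[i]) (n : nat) (x : vilenkin m) :
    R[i] :=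
  \sum_(k < n) fourier_coef f k * vilenkin_psi k x.

Definition Qsum (q : nat -> R) (n : nat) : R := \sum_(k < n) q k.

Definition T_mean (q : nat -> R) (f : vilenkin m -> R[i]) (n : nat)
    (x : vilenkin m) : R[i] :=
  ((Qsum q n)^-1)%:C * \sum_(k < n) (q k)%:C * partial_sum f k x.

End vilenkin_fourier.

(* Main.v *)
Require Import Defs.
From mathcomp Require Import all_boot all_order all_algebra.
From mathcomp Require Import all_classical all_reals all_analysis.
From mathcomp Require Import measurable_realfun complex zify ring lra.

Set Implicit Arguments.
Unset Strict Implicit.
Unset Printing Implicit Defensive.

Import Order.TTheory GRing.Theory Num.Theory.
Import numFieldNormedType.Exports.

Local Open Scope classical_set_scope.
Local Open Scope ring_scope.

(** Write A_n(x) for the sum over k < n of S_k f(x) - f(x).  Summation by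
    parts expresses Q_n (T_n f(x) - f(x)) through the A_j(x), j <= n, with
    coefficients whose absolute values add up to at most 2 q_(n-1), because q is
    non-decreasing (norm_abel_sum).  Since n q_(n-1) / Q_n is bounded, it is
    enough that A_n(x) = o(n) at almost every x (partial_sum_dev_le): the
    theorem reduces to the almost everywhere summability of the Fourier series
    by arithmetic means.

    The sum of S_k f(x) over k < n is the integral of f(y) F_n(x, y), where F_n
    is a sum of Dirichlet kernels and has integral n - 1 in y.  Both kernels
    are polynomials in the ratios z_k of the k-th Rademacher functions at x and
    y, which are m_k-th roots of unity, equal to 1 exactly when x_k = y_k.  The
    mixed-radix expansion of n gives a recursion for F_n, and boundedness of m
    turns it into |F_n| <= C sum_(l < N) M_l kappa_l for n < M_N
    (norm_fejer_le).  Here kappa_l(x, y) is M_l if x and y agree in their first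
    l coordinates, plus the sum of the M_t over those t < l such that x and y
    agree in the first l coordinates with the possible exception of the t-th.
    Hence A_n(x) = o(n) as soon as the integral of |f(y) - f(x)| kappa_l(x, y)
    in y tends to 0 as l grows.

    That this happens almost everywhere (osc_cvg) is proved by density.  If f
    depends on finitely many coordinates only, it happens everywhere, since the
    mass of kappa_l outside any fixed cylinder around x is O(1 / M_l); and such
    functions are dense in L1 (L1_approx_integrable).  What remains is a weak
    type (1,1) bound for the maximal operator sup_l of the integral of
    g(y) kappa_l(x, y), for g >= 0 (integral_majorant_le, mu_exceptional_le).
    No cancellation is involved.  Let Omega_n be the set of the x such that n
    is the first level at which the average of g over the cylinder of x exceeds
    a given threshold; the measures of the Omega_n add up to at most the
    integral of g divided by the threshold.  Suppose that a cylinder of level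
    t + d becomes one with a large average after its t-th coordinate is
    changed.  Then either this already happens at a level n <= t, where the
    change is invisible, so that x is in Omega_n, or x differs in the t-th
    coordinate from a point of Omega_n with t < n <= t + d.  For a given d
    there are d such t for each n, so the set of these x has a measure at most
    1 + d B times the sum of the measures of the Omega_n, B being a bound of m
    (mu_shift_cover_le).  In kappa_l, such a changed cylinder has relative
    weight M_t / M_(t + d) <= 2 ^ -d, which leaves room for a threshold that
    grows like (3/2) ^ d: the weighted averages still have a bounded sum, and
    the measures of the exceptional sets are summable in d. *)

(** * Mixed-radix digits and the Fejer kernel *)

Section digits.
Variable m : nat -> nat.
Hypothesis m_ge2 : forall k, (2 <= m k)%N.

Lemma vM0 : vM m 0 = 1%N. Proof. by rewrite /vM big_ord0. Qed.

Lemma vMS n : vM m n.+1 = (m n * vM m n)%N.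
Proof. by rewrite /vM big_ord_recr /= mulnC. Qed.

Lemma vM_gt0 n : (0 < vM m n)%N.
Proof. by apply: leq_trans (vM_gt n m_ge2). Qed.

Lemma vM_dvd j n : (j <= n)%N -> (vM m j %| vM m n)%N.
Proof.
elim: n => [|n IH]; first by rewrite leqn0 => /eqP ->.
rewrite leq_eqVlt => /predU1P[->//|jn].
by rewrite vMS dvdn_mull// IH.
Qed.

Lemma vM_leq j n : (j <= n)%N -> (vM m j <= vM m n)%N.
Proof. by move=> /vM_dvd; apply: dvdn_leq; exact: vM_gt0. Qed.

Lemma vdigit_small n j : (n < vM m j)%N -> vdigit m n j = 0%N.
Proof. by move=> nj; rewrite /vdigit divn_small// mod0n. Qed.

Lemma vdigit_addl a N i j : (j < N)%N -> vdigit m (a * vM m N + i) j = vdigit m i j.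
Proof.
move=> jN; rewrite /vdigit.
have /dvdnP[c ->] : (m j * vM m j %| vM m N)%N by rewrite -vMS vM_dvd.
by rewrite !mulnA divnMDl ?vM_gt0// modnMDl.
Qed.

Lemma vdigit_top a N i : (a < m N)%N -> (i < vM m N)%N ->
  vdigit m (a * vM m N + i) N = a.
Proof.
by move=> am iN; rewrite /vdigit divnMDl ?vM_gt0// divn_small// addn0 modn_small.
Qed.

Lemma vM_block a N i : (a < m N)%N -> (i < vM m N)%N ->
  (a * vM m N + i < vM m N.+1)%N.
Proof. by rewrite vMS; nia. Qed.

End digits.

Section kernel.
Variables (C : numFieldType) (m : nat -> nat).
Hypothesis m_ge2 : forall k, (2 <= m k)%N.
Variable z : nat -> C.
Hypothesis z_root : forall k, z k ^+ m k = 1.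

Definition chi n : C := \prod_(k < n) z k ^+ vdigit m n k.
Definition dirichlet n : C := \sum_(k < n) chi k.
Definition fejer_sum n : C := \sum_(k < n) dirichlet k.

Let normz k : `|z k| = 1.
Proof.
apply/eqP; have /eqP := congr1 Num.norm (z_root k).
rewrite normrX normr1 pexpr_eq1 //.
exact: leq_trans (m_ge2 k).
Qed.

Lemma chi_widen n N : (n < vM m N)%N ->
  chi n = \prod_(k < N) z k ^+ vdigit m n k.
Proof.
have H a b : (n < vM m a)%N -> (a <= b)%N ->
    \prod_(k < a) z k ^+ vdigit m n k = \prod_(k < b) z k ^+ vdigit m n k.
  move=> na ab; rewrite -!(big_mkord xpredT (fun k => z k ^+ vdigit m n k)).
  rewrite (big_cat_nat _ ab)//= [X in _ = _ * X]big_nat [X in _ = _ * X]big1 ?mulr1//.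
  move=> i /andP[ai _]; rewrite vdigit_small//.
  exact: leq_trans na (vM_leq m_ge2 ai).
move=> nN; rewrite /chi (@H n (maxn n N)) ?leq_maxl//; last exact: vM_gt.
by rewrite -(H N) ?leq_maxr.
Qed.

Lemma chi_block a N i : (a < m N)%N -> (i < vM m N)%N ->
  chi (a * vM m N + i) = z N ^+ a * chi i.
Proof.
move=> am iN; rewrite (@chi_widen _ N.+1) ?vM_block// big_ord_recr /=.
rewrite vdigit_top// mulrC; congr (_ * _).
by rewrite (@chi_widen i N)//; apply: eq_bigr => k _; rewrite vdigit_addl.
Qed.

(** The digits of a M_N + i are those of i, with a at place N, so the characters
    of the block starting at a M_N are those of the first block times z_N ^ a. *)
Lemma dirichlet_block a N i : (a < m N)%N -> (i <= vM m N)%N ->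
  dirichlet (a * vM m N + i) = dirichlet (a * vM m N) + z N ^+ a * dirichlet i.
Proof.
move=> am iN; rewrite /dirichlet big_split_ord /= mulr_sumr; congr (_ + _).
by apply: eq_bigr => k _; rewrite chi_block// (leq_trans _ iN).
Qed.

Lemma dirichlet_mul a N : (a <= m N)%N ->
  dirichlet (a * vM m N) = (\sum_(b < a) z N ^+ b) * dirichlet (vM m N).
Proof.
elim: a => [|a IH] am; first by rewrite mul0n /dirichlet !big_ord0 mul0r.
rewrite mulSn addnC dirichlet_block// IH; last exact: ltnW.
by rewrite big_ord_recr /= mulrDl.
Qed.

Lemma sum_root k : \sum_(b < m k) z k ^+ b = (m k)%:R * (z k == 1)%:R.
Proof.
have [zk|zk] := eqVneq (z k) 1.
  rewrite mulr1 zk -[RHS]mul1r -[X in X%:R]card_ord mulr_natr -sumr_const.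
  by apply: eq_bigr => i _; rewrite expr1n.
rewrite mulr0; apply/eqP.
have /eqP : (z k - 1) * \sum_(b < m k) z k ^+ b = 0.
  by rewrite -subrX1 z_root subrr.
by rewrite mulf_eq0 subr_eq0 (negbTE zk).
Qed.

Definition agree N : bool := [forall k : 'I_N, z k == 1].
Definition agree_off N t : bool := [forall k : 'I_N, (k != t :> nat) ==> (z k == 1)].

Lemma agreeS N : agree N.+1 = agree N && (z N == 1).
Proof.
apply/forallP/andP => [H|[/forallP H zN] k].
  split; last exact: (H ord_max).
  by apply/forallP => k; exact: (H (widen_ord (leqnSn N) k)).
have [kN|] := ltnP k N; first exact: (H (Ordinal kN)).
move=> Nk; have -> : val k = N by apply/eqP; rewrite eqn_leq -ltnS ltn_ord Nk.
by [].
Qed.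

(** Each new level multiplies the kernel by the sum of the powers of z_N, which
    is m_N or 0: this is the Paley formula for D_(M_N). *)
Lemma dirichlet_vM N : dirichlet (vM m N) = (vM m N)%:R * (agree N)%:R.
Proof.
elim: N => [|N IH].
  rewrite vM0 /dirichlet big_ord_recl big_ord0 /chi big_ord0 addr0.
  suff -> : agree 0 by rewrite mulr1.
  by apply/forallP => -[].
rewrite vMS dirichlet_mul// sum_root IH agreeS natrM.
by case: (agree N); case: (z N == 1); rewrite ?mulr0 ?mulr1 ?mul0r.
Qed.

Lemma fejer_block a N i : (a < m N)%N -> (i <= vM m N)%N ->
  fejer_sum (a * vM m N + i) =
  fejer_sum (a * vM m N) + i%:R * dirichlet (a * vM m N) + z N ^+ a * fejer_sum i.
Proof.
move=> am iN; rewrite /fejer_sum big_split_ord /= -addrA; congr (_ + _).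
have -> : i%:R * dirichlet (a * vM m N) = \sum_(k < i) dirichlet (a * vM m N).
  by rewrite sumr_const card_ord mulr_natl.
rewrite mulr_sumr -big_split /=.
by apply: eq_bigr => k _; rewrite dirichlet_block// ltnW// (leq_trans _ iN).
Qed.

(** Both terms matter: when a = m_N, the sum of the powers of z_N cancels the
    second one unless z_N = 1, which is why the bound on F_(M_N) does not
    deteriorate from one level to the next. *)
Lemma fejer_mul a N : (a <= m N)%N ->
  fejer_sum (a * vM m N) =
  (vM m N)%:R * dirichlet (vM m N) * (\sum_(b < a) \sum_(c < b) z N ^+ c) +
  (\sum_(b < a) z N ^+ b) * fejer_sum (vM m N).
Proof.
elim: a => [|a IH] am.
  by rewrite mul0n /fejer_sum !big_ord0 mulr0 mul0r addr0.
rewrite mulSn addnC fejer_block// IH ?dirichlet_mul//; [|exact: ltnW..].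
by rewrite !big_ord_recr /=; ring.
Qed.

(** The kernel kappa_N of the introduction, with the Rademacher ratios z as the only
    data. *)
Definition fejer_majorant N : C :=
  (vM m N)%:R * (agree N)%:R + \sum_(t < N) (vM m t)%:R * (agree_off N t)%:R.

Lemma fejer_majorant_ge0 N : 0 <= fejer_majorant N.
Proof. by rewrite addr_ge0 ?mulr_ge0 ?sumr_ge0// => t _; rewrite mulr_ge0. Qed.

Lemma norm_geom k n : `|\sum_(b < n) z k ^+ b| <= n%:R.
Proof.
rewrite (le_trans (ler_norm_sum _ _ _))//.
under eq_bigr do rewrite normrX normz expr1n.
by rewrite sumr_const card_ord.
Qed.

Lemma norm_geom2 k a : `|\sum_(b < a) \sum_(c < b) z k ^+ c| <= (a * a)%:R.
Proof.
rewrite (le_trans (ler_norm_sum _ _ _))//.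
rewrite (@le_trans _ _ (\sum_(b < a) a%:R))//; last first.
  by rewrite sumr_const card_ord natrM mulr_natr.
rewrite ler_sum// => b _; rewrite (le_trans (norm_geom _ _))//.
by rewrite ler_nat ltnW.
Qed.

Lemma agree_off_last N : agree_off N.+1 N = agree N.
Proof.
apply/forallP/forallP => H k.
  have := H (widen_ord (leqnSn N) k).
  by rewrite /= (ltn_eqF (ltn_ord k)).
have [kN|Nk] := ltnP k N; first by rewrite (H (Ordinal kN)) implybT.
have -> : val k = N by apply/eqP; rewrite eqn_leq -ltnS ltn_ord Nk.
by rewrite eqxx.
Qed.

Lemma agree_offS N t : agree_off N t && (z N == 1) -> agree_off N.+1 t.
Proof.
move=> /andP[/forallP H zN]; apply/forallP => k.
have [kN|Nk] := ltnP k N; first exact: (H (Ordinal kN)).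
have -> : val k = N by apply/eqP; rewrite eqn_leq -ltnS ltn_ord Nk.
by rewrite zN implybT.
Qed.

Lemma agree_le_fejer_majorant N : (vM m N)%:R * (agree N)%:R <= fejer_majorant N.
Proof. by rewrite lerDl sumr_ge0// => t _; rewrite mulr_ge0. Qed.

(** Passing to level N + 1 when z_N = 1 replaces the weight M_N of the full
    agreement by M_(N + 1) and turns the old weight into the term t = N. *)
Lemma fejer_majorantS_ge N : (z N == 1) ->
  fejer_majorant N + (vM m N.+1)%:R * (agree N)%:R <= fejer_majorant N.+1.
Proof.
move=> zN; rewrite /fejer_majorant agreeS zN andbT big_ord_recr /= agree_off_last.
rewrite [leLHS]addrC lerD2l [leLHS]addrC lerD2r ler_sum// => t _.
rewrite ler_wpM2l// ler_nat; case: (boolP (agree_off N t)) => // H.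
by rewrite agree_offS// H.
Qed.

Lemma agree_le_fejer_majorantS N : (vM m N)%:R * (agree N)%:R <= fejer_majorant N.+1.
Proof.
rewrite /fejer_majorant big_ord_recr /= agree_off_last addrA lerDr.
by rewrite addr_ge0 ?mulr_ge0 ?sumr_ge0// => t _; rewrite mulr_ge0.
Qed.

Variable B : nat.
Hypothesis m_le : forall k, (m k <= B)%N.

(** Induction on the level.  If z_N = 1, the new term is paid for by the growth of
    the weight of full agreement; if not, the kernel of level N is cancelled
    and the new term is supported where only the N-th coordinates differ. *)
Lemma norm_fejer_vM N : `|fejer_sum (vM m N)| <= B%:R * (vM m N)%:R * fejer_majorant N.
Proof.
have B1 : 1 <= B%:R :> C.
  by rewrite ler1n; apply: leq_trans (m_le 0); apply: leq_trans (m_ge2 0).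
elim: N => [|N IH].
  rewrite vM0 /fejer_sum big_ord_recl big_ord0 /dirichlet big_ord0 addr0 normr0.
  by rewrite !mulr_ge0 ?fejer_majorant_ge0.
rewrite vMS fejer_mul// dirichlet_vM sum_root -vMS.
have G : `|\sum_(b < m N) \sum_(c < b) z N ^+ c| <= (m N * m N)%:R.
  exact: norm_geom2.
rewrite (le_trans (ler_normD _ _))// !normrM !normr_nat.
have [zN|zN] := boolP (z N == 1).
  rewrite mulr1.
  have H1 := fejer_majorantS_ge zN.
  rewrite (@le_trans _ _ (B%:R * (vM m N.+1)%:R *
     (fejer_majorant N + (vM m N.+1)%:R * (agree N)%:R)))//; last first.
    by rewrite ler_wpM2l ?mulr_ge0.
  rewrite mulrDr addrC lerD//.
    by rewrite vMS natrM (le_trans (ler_wpM2l _ IH))// !mulrA (mulrC (m N)%:R).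
  rewrite (@le_trans _ _ ((vM m N)%:R * ((vM m N)%:R * (agree N)%:R) * (m N * m N)%:R))//.
    by rewrite ler_wpM2l// !mulr_ge0.
  rewrite vMS !natrM.
  rewrite [leLHS](_ : _ = (m N)%:R * (vM m N)%:R *
    ((m N)%:R * (vM m N)%:R * (agree N)%:R)); last by ring.
  by rewrite -[leRHS]mulrA ler_peMl// !mulr_ge0.
rewrite mulr0 mul0r addr0.
have H1 := agree_le_fejer_majorantS N.
rewrite (@le_trans _ _ (B%:R * (vM m N.+1)%:R * ((vM m N)%:R * (agree N)%:R)))//; last first.
  by rewrite ler_wpM2l ?mulr_ge0.
rewrite (@le_trans _ _ ((vM m N)%:R * ((vM m N)%:R * (agree N)%:R) * (m N * m N)%:R))//.
  by rewrite ler_wpM2l// !mulr_ge0.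
rewrite vMS !natrM.
rewrite [leLHS](_ : _ = (m N)%:R *
  ((m N)%:R * (vM m N)%:R * ((vM m N)%:R * (agree N)%:R))); last by ring.
by rewrite -[leRHS]mulrA ler_wpM2r ?mulr_ge0// ler_nat.
Qed.

(** Write n = a M_N + i with i < M_N: the block recursion leaves F_i, to which the
    induction hypothesis applies, and terms controlled by the majorant of
    level N. *)
Lemma norm_fejer_le N n : (n < vM m N)%N ->
  `|fejer_sum n| <= 3 * B%:R ^+ 2 * \sum_(l < N) (vM m l)%:R * fejer_majorant l.
Proof.
have B1 : 1 <= B%:R :> C.
  by rewrite ler1n; apply: leq_trans (m_le 0); apply: leq_trans (m_ge2 0).
elim: N n => [|N IH] n.
  rewrite vM0 ltnS leqn0 => /eqP ->.
  by rewrite /fejer_sum !big_ord0 normr0 mulr0.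
move=> nN; have M0 := vM_gt0 m_ge2 N.
rewrite (divn_eq n (vM m N)); set a := (n %/ _)%N; set i := (n %% _)%N.
have iN : (i < vM m N)%N by rewrite ltn_mod.
have am : (a < m N)%N by rewrite ltn_divLR// -vMS.
rewrite fejer_block//; last exact: ltnW.
rewrite (le_trans (ler_normD _ _))// big_ord_recr /= mulrDr addrC lerD//.
  by rewrite normrM normrX normz expr1n mul1r IH.
have aB : (a <= B)%N by rewrite (leq_trans (ltnW am)).
rewrite fejer_mul// ?dirichlet_mul//; [|exact: ltnW..].
rewrite dirichlet_vM.
have G2 := norm_geom2 N a; have G1 := norm_geom N a.
rewrite (le_trans (ler_normD _ _))//.
(* one summand for each of the two terms of fejer_mul, and one for
   i D_(a M_N) *)
rewrite (@le_trans _ _ (B%:R ^+ 2 * ((vM m N)%:R * fejer_majorant N) +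
    B%:R * (B%:R * (vM m N)%:R * fejer_majorant N) +
    B%:R ^+ 2 * ((vM m N)%:R * fejer_majorant N)))//; last first.
  by rewrite le_eqVlt; apply/orP; left; apply/eqP; ring.
rewrite lerD//.
  rewrite (le_trans (ler_normD _ _))// lerD//.
    rewrite normrM mulrC ler_pM// ?(le_trans G2)//.
      by rewrite expr2 -natrM ler_nat leq_mul.
    by rewrite !normrM !normr_nat ler_wpM2l// agree_le_fejer_majorant.
  rewrite normrM ler_pM// ?norm_fejer_vM//.
  by rewrite (le_trans G1)// ler_nat.
rewrite !normrM !normr_nat mulrCA ler_pM ?mulr_ge0//.
  rewrite (le_trans G1)// (@le_trans _ _ B%:R) ?ler_nat//.
  by rewrite expr2 ler_peMl.
by rewrite ler_pM ?mulr_ge0// ?agree_le_fejer_majorant// ler_nat ltnW.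
Qed.

End kernel.

(** * Cylinders of the Vilenkin group *)

Section cells.
Variable m : nat -> nat.
Hypothesis m_ge2 : forall k, (2 <= m k)%N.
Local Notation G := (vilenkin m).

Definition cell n (x : G) : set G := [set y | forall k, (k < n)%N -> y k = x k].
Definition cell_off n t (x : G) : set G :=
  [set y | forall k, (k < n)%N -> k <> t -> y k = x k].
Definition of_level n (T : Type) (h : G -> T) :=
  forall x y, (forall k, (k < n)%N -> x k = y k) -> h x = h y.
(** The digits of c as coordinates: the points digit_point c with c < M_n meet every
    cylinder of level n exactly once. *)
Definition digit_point (c : nat) : G := fun k => (vdigit m c k)%:R.

Lemma measurable_coord k (A : set 'Z_(m k)) : measurable [set y : G | A (y k)].
Proof. by apply: sub_sigma_algebra; exists k, A. Qed.

Lemma measurable_cell_off n t x : measurable (cell_off n t x).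
Proof.
rewrite (_ : cell_off n t x = \bigcap_(k in [set k | (k < n)%N /\ k <> t])
  [set y : G | [set x k] (y k)]).
  by apply: bigcap_measurableType => k _; exact: measurable_coord.
by apply/seteqP; split => [y H k [kn kt]|y H k kn kt]; [exact: H|exact: H].
Qed.

Lemma cell_offE n x : cell n x = cell_off n n x.
Proof.
apply/seteqP; split => [y H k kn _|y H k kn]; first exact: H.
by apply: H => //; apply/eqP; rewrite ltn_eqF.
Qed.

Lemma measurable_cell n x : measurable (cell n x).
Proof. by rewrite cell_offE; exact: measurable_cell_off. Qed.

Lemma digit_point_exists n (x : G) :
  exists2 c, (c < vM m n)%N & forall k, (k < n)%N -> digit_point c k = x k.
Proof.
elim: n => [|n [c cM cx]]; first by exists 0%N; rewrite ?vM0.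
have xn : (x n < m n)%N.
  have := ltn_ord (x n); rewrite {2}Zp_cast//.
exists (x n * vM m n + c)%N; first exact: vM_block.
move=> k; rewrite ltnS leq_eqVlt => /predU1P[->|kn].
  by rewrite /digit_point vdigit_top// natr_Zp.
by rewrite /digit_point vdigit_addl// -cx.
Qed.

Lemma digit_point_inj n c c' : (c < vM m n)%N -> (c' < vM m n)%N ->
  (forall k, (k < n)%N -> digit_point c k = digit_point c' k) -> c = c'.
Proof.
elim: n c c' => [|n IH] c c'.
  by rewrite vM0 !ltnS !leqn0 => /eqP -> /eqP ->.
move=> cM cM' H; have M0 := vM_gt0 m_ge2 n.
have a_lt e : (e < vM m n.+1)%N -> (e %/ vM m n < m n)%N.
  by move=> eM; rewrite ltn_divLR// -vMS.
have digitE e k : nat_of_ord (digit_point e k) = vdigit m e k.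
  by rewrite /digit_point val_Zp_nat// modn_small// vdigit_lt// ltnW.
rewrite (divn_eq c (vM m n)) (divn_eq c' (vM m n)).
congr (_ * _ + _)%N.
  have := congr1 (@nat_of_ord _) (H n (ltnSn n)).
  by rewrite !digitE /vdigit !modn_small// a_lt.
apply: IH; rewrite ?ltn_mod// => k kn.
apply: val_inj => /=; rewrite !digitE.
have := congr1 (@nat_of_ord _) (H k (ltnW kn)).
rewrite !digitE {1}(divn_eq c (vM m n)) {1}(divn_eq c' (vM m n)).
by rewrite !vdigit_addl.
Qed.

Lemma level_cover n (A : set G) : of_level n A ->
  A = \big[setU/set0]_(c < vM m n | `[< A (digit_point c) >]) cell n (digit_point c).
Proof.
move=> An; rewrite -bigcup_seq_cond; apply/seteqP; split => x.
  move=> Ax; have [c cM cx] := digit_point_exists n x.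
  exists (Ordinal cM) => /=; last by move=> k kn; rewrite cx.
  by rewrite mem_index_enum; apply/asboolP; rewrite (An _ x).
by move=> [c /= /andP[_ /asboolP Ac] xc]; rewrite (An _ (digit_point c)).
Qed.

Lemma level_measurable n (A : set G) : of_level n A -> measurable A.
Proof.
move=> /level_cover ->; apply: bigsetU_measurable => c _.
exact: measurable_cell.
Qed.

Lemma trivIset_cell n : trivIset [set: 'I_(vM m n)] (fun c => cell n (digit_point c)).
Proof.
move=> c c' _ _ [x [xc xc']]; apply: val_inj.
by apply: (@digit_point_inj n _ _ (ltn_ord c) (ltn_ord c')) => k kn; rewrite -xc// xc'.
Qed.

Variables (R : realType) (mu : {measure set G -> \bar R}).
Hypothesis mu_product : is_product_measure mu.

Lemma mu_cell_off n t x : (t < n)%N ->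
  mu (cell_off n t x) = ((m t)%:R / (vM m n)%:R)%:E.
Proof.
move=> tn.
have := mu_product n (fun k => if k == t then finset.setTfor _ else finset.set1 (x k)).
rewrite [X in mu X](_ : _ = cell_off n t x).
  move=> ->; congr EFin.
  rewrite /vM natr_prod (bigD1 (Ordinal tn))//= [in RHS](bigD1 (Ordinal tn))//= eqxx.
  rewrite cardsT card_ord Zp_cast// divff ?pnatr_eq0; last by have := m_ge2 t; lia.
  rewrite mul1r invfM mulrA divff ?mul1r; last first.
    by rewrite pnatr_eq0; have := m_ge2 t; lia.
  rewrite -prodfV; apply: eq_bigr => k kt.
  by rewrite ifF ?cards1 ?mul1r//; apply/negbTE.
apply/seteqP; split => y H k kn.
  by move=> kt; have := H k kn; rewrite ifF ?inE => [/eqP//|]; apply/eqP.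
by case: ifP => [_|/eqP kt]; rewrite ?inE ?H.
Qed.

Lemma mu_cell n x : mu (cell n x) = ((vM m n)%:R^-1)%:E.
Proof.
have := mu_product n (fun k => finset.set1 (x k)).
rewrite [X in mu X](_ : _ = cell n x).
  move=> ->; congr EFin; rewrite /vM natr_prod -prodfV.
  by apply: eq_bigr => k _; rewrite cards1 mul1r.
by apply/seteqP; split => y H k kn; have := H k kn; rewrite inE => /eqP.
Qed.

Lemma mu_setT : mu setT = 1%E.
Proof.
have <- : cell 0 point = setT by apply/seteqP; split.
by rewrite mu_cell vM0 invr1.
Qed.

(** A set of level n is a finite disjoint union of cylinders. *)
Lemma ge0_integral_level n (A : set G) (g : G -> \bar R) :
  of_level n A -> measurable_fun setT g -> (forall x, 0 <= g x)%E ->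
  (\int[mu]_(x in A) g x =
   \sum_(c < vM m n | `[< A (digit_point c) >])
     \int[mu]_(x in cell n (digit_point c)) g x)%E.
Proof.
move=> An mg g0; rewrite {1}(level_cover An) -big_filter.
rewrite ge0_integral_bigsetU//.
- by rewrite big_filter.
- by move=> c; exact: measurable_cell.
- by rewrite filter_uniq// index_enum_uniq.
- by apply: sub_trivIset (@trivIset_cell n).
- exact: measurable_funTS.
Qed.

Lemma mu_level n (A : set G) : of_level n A ->
  mu A = (\sum_(c < vM m n | `[< A (digit_point c) >]) (vM m n)%:R^-1)%:E.
Proof.
move=> An; rewrite -[LHS]mul1e -integral_cst; last exact: level_measurable An.
rewrite (@ge0_integral_level n)// -sumEFin; apply: eq_bigr => c _.
by rewrite integral_cst ?mul1e ?mu_cell//; exact: measurable_cell.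
Qed.

End cells.

(** * Shifted maximal averages *)

Lemma measure_bigsetU_le d (T : measurableType d) (R : realType)
    (mu : {measure set T -> \bar R}) (I : Type) (s : seq I) (P : pred I)
    (F : I -> set T) : (forall i, measurable (F i)) ->
  (mu (\big[setU/set0]_(i <- s | P i) F i) <= \sum_(i <- s | P i) mu (F i))%E.
Proof.
move=> mF; elim: s => [|i s IH]; first by rewrite !big_nil measure0.
rewrite !big_cons; case: ifP => // _.
rewrite (le_trans (measureU2 _ _ _))//; first exact: bigsetU_measurable.
by rewrite leeD2l.
Qed.

Section maximal.
Variables (R : realType) (m : nat -> nat).
Hypothesis m_ge2 : forall k, (2 <= m k)%N.
Variable mu : {measure set (vilenkin m) -> \bar R}.
Hypothesis mu_product : is_product_measure mu.
Variable B : nat.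
Hypothesis m_le : forall k, (m k <= B)%N.
Local Notation G := (vilenkin m).

Definition replace_coord t (r : 'Z_(m t)) (x : G) : G :=
  fun k => @eqtype.dfwith nat (fun k => 'Z_(m k)) x t r k.

Lemma replace_coord_out t (r : 'Z_(m t)) x k : k <> t -> replace_coord r x k = x k.
Proof. by move=> kt; rewrite /replace_coord dfwith_out//; apply/eqP => tk; exact: kt. Qed.

Lemma cell_eq n (x y : G) : (forall k, (k < n)%N -> x k = y k) -> cell n x = cell n y.
Proof.
by move=> xy; apply/seteqP; split => z H k kn; rewrite H// xy.
Qed.

Variable g : G -> \bar R.
Hypothesis mg : measurable_fun setT g.
Hypothesis g0 : forall x, (0 <= g x)%E.

Definition large_avg (l : R) n : set G :=
  [set x | (l%:E < (vM m n)%:R%:E * \int[mu]_(y in cell n x) g y)%E].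

Definition first_large (l : R) n : set G :=
  [set x | large_avg l n x /\ forall k, (k < n)%N -> ~ large_avg l k x].

Definition first_large_off (l : R) n t : set G :=
  [set x | exists r : 'Z_(m t), first_large l n (replace_coord r x)].

Lemma level_large_avg l n n' : (n <= n')%N -> of_level n' (large_avg l n).
Proof.
move=> nn' x y xy; rewrite /large_avg/= (@cell_eq n x y)// => k kn.
by rewrite xy// (leq_trans kn).
Qed.

Lemma level_first_large l n : of_level n (first_large l n).
Proof.
suff H x y : (forall k, (k < n)%N -> x k = y k) ->
    first_large l n x -> first_large l n y.
  move=> x y xy; apply/propext; split; apply: H => // k kn.
  by rewrite xy.
move=> xy [lx sx]; split.
  by have := level_large_avg l (leqnn n) xy => <-.
by move=> k kn; have := level_large_avg l (ltnW kn) xy => <-; exact: sx.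
Qed.

Lemma level_first_large_off l n t : of_level n (first_large_off l n t).
Proof.
suff H x y : (forall k, (k < n)%N -> x k = y k) ->
    first_large_off l n t x -> first_large_off l n t y.
  move=> x y xy; apply/propext; split; apply: H => // k kn.
  by rewrite xy.
move=> xy [r Hr]; exists r.
rewrite (@level_first_large l n _ (replace_coord r x))// => k kn.
have [->|/eqP kt] := eqVneq k t; first by rewrite /replace_coord !dfwith_in.
by rewrite !replace_coord_out// xy.
Qed.

Lemma large_avg_first l n x : large_avg l n x ->
  exists2 k, (k <= n)%N & first_large l k x.
Proof.
elim/ltn_ind: n => n IH ln.
have [[k [kn lk]]|H] := pselect (exists k, (k < n)%N /\ large_avg l k x).
  by have [j jk fj] := IH _ kn lk; exists j => //; rewrite (leq_trans jk)// ltnW.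
by exists n => //; split => // k kn lk; apply: H; exists k.
Qed.

Lemma trivIset_first_large l : trivIset setT (first_large l).
Proof.
move=> i j _ _ [x [[li si] [lj sj]]].
have [ij|ji|//] := ltngtP i j; first by have := sj _ ij.
by have := si _ ji.
Qed.

Lemma measurable_first_large l n : measurable (first_large l n).
Proof. exact: (level_measurable m_ge2 (@level_first_large l n)). Qed.

Lemma measurable_first_large_off l n t : measurable (first_large_off l n t).
Proof. exact: (level_measurable m_ge2 (@level_first_large_off l n t)). Qed.

(** On each of the cylinders that make up first_large l n the average of g exceeds l. *)
Lemma mu_first_large_le l n : 0 < l ->
  (l%:E * mu (first_large l n) <= \int[mu]_(x in first_large l n) g x)%E.
Proof.
move=> l0; have Ln := @level_first_large l n.
rewrite (mu_level m_ge2 mu_product Ln) (ge0_integral_level m_ge2 _ Ln)//.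
rewrite -sumEFin ge0_sume_distrr; last by move=> c _; rewrite lee_fin.
apply: lee_sum => c /asboolP [lc _].
have M0 : 0 < (vM m n)%:R :> R by rewrite ltr0n vM_gt0.
by rewrite lee_pdivrMr// muleC ltW.
Qed.

Lemma sum_first_large l : 0 < l ->
  (l%:E * \sum_(n <oo) mu (first_large l n) <= \int[mu]_x g x)%E.
Proof.
move=> l0; rewrite -nneseriesZl//.
rewrite (@le_trans _ _ (\int[mu]_(x in \bigcup_n first_large l n) g x)%E)//.
  rewrite ge0_integral_bigcup//; first last.
  - exact: trivIset_first_large.
  - exact: measurable_funTS.
  - by move=> k; exact: measurable_first_large.
  apply: lee_nneseries => [i _ _|n _]; first by rewrite mule_ge0 ?lee_fin// ltW.
  exact: mu_first_large_le.
apply: ge0_subset_integral => //.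
by apply: bigcup_measurable => k _; exact: measurable_first_large.
Qed.

Lemma mu_cell_off_le n t x :
  (mu (cell_off n t x) <= ((m t)%:R / (vM m n)%:R)%:E)%E.
Proof.
have [tn|nt] := ltnP t n; first by rewrite mu_cell_off.
rewrite (_ : cell_off n t x = cell n x).
  rewrite mu_cell// lee_fin ler_peMl// ler1n; exact: ltnW.
apply/seteqP; split => y H k kn; first by apply: H => //; lia.
by move=> _; exact: H.
Qed.

(** Freeing the t-th coordinate multiplies the measure of a cylinder by m_t if t is
    below its level, and leaves the cylinder unchanged otherwise. *)
Lemma mu_first_large_off_le l n t :
  (mu (first_large_off l n t) <= (m t)%:R%:E * mu (first_large l n))%E.
Proof.
rewrite (mu_level m_ge2 mu_product (@level_first_large l n)).
set P := fun c : 'I_(vM m n) => `[< first_large l n (digit_point m c) >].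
rewrite (@le_trans _ _ (mu (\big[setU/set0]_(c < vM m n | P c)
    cell_off n t (digit_point m c))))//.
  apply: le_measure; rewrite ?inE.
  - exact: measurable_first_large_off.
  - by apply: bigsetU_measurable => c _; exact: measurable_cell_off.
  move=> x [r fr]; rewrite -bigcup_seq_cond.
  have [c cM cx] := digit_point_exists m_ge2 n (replace_coord r x).
  exists (Ordinal cM) => /=.
    rewrite mem_index_enum; apply/asboolP.
    by rewrite (@level_first_large l n _ (replace_coord r x)).
  by move=> k kn kt; rewrite cx// replace_coord_out.
rewrite (le_trans (measure_bigsetU_le _ _ _ _))//.
  by move=> c; exact: measurable_cell_off.
rewrite -sumEFin ge0_sume_distrr; last by move=> c _; rewrite lee_fin.
apply: lee_sum => c _; rewrite -EFinM; exact: mu_cell_off_le.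
Qed.

(** The index n.-1 - s runs through the d coordinates that precede the n-th one; the
    truncated subtraction only repeats the coordinate 0. *)
Definition shift_cover (l : R) d : set G :=
  \bigcup_n (first_large l n `|`
    \big[setU/set0]_(s < d) first_large_off l n (n.-1 - s)%N).

Lemma measurable_shift_cover l d : measurable (shift_cover l d).
Proof.
apply: bigcup_measurable => n _; apply: measurableU.
  exact: measurable_first_large.
by apply: bigsetU_measurable => s _; exact: measurable_first_large_off.
Qed.

Lemma mu_shift_cover_le l d : 0 < l ->
  (mu (shift_cover l d) <= ((1 + d * B)%:R / l)%:E * \int[mu]_x g x)%E.
Proof.
move=> l0.
rewrite (@le_trans _ _ (\sum_(n <oo) (1 + d * B)%:R%:E * mu (first_large l n))%E)//.
  apply: (@le_trans _ _ (\sum_(n <oo) mu (first_large l n `|`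
    \big[setU/set0]_(s < d) first_large_off l n (n.-1 - s)%N))%E).
    apply: measure_sigma_subadditive => //; last exact: measurable_shift_cover.
    move=> n; apply: measurableU; first exact: measurable_first_large.
    by apply: bigsetU_measurable => s _; exact: measurable_first_large_off.
  apply: lee_nneseries => [i _ _|n _]; first exact: measure_ge0.
  rewrite (le_trans (measureU2 _ _ _))//.
  - exact: measurable_first_large.
  - by apply: bigsetU_measurable => s _; exact: measurable_first_large_off.
  rewrite natrD EFinD ge0_muleDl ?lee_fin// mul1e leeD2l//.
  rewrite (le_trans (measure_bigsetU_le _ _ _ _))//.
    by move=> s; exact: measurable_first_large_off.
  rewrite (@le_trans _ _ (\sum_(s < d) B%:R%:E * mu (first_large l n))%E)//.
    apply: lee_sum => s _; rewrite (le_trans (mu_first_large_off_le _ _ _))//.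
    by rewrite lee_wpmul2r// lee_fin ler_nat.
  rewrite -ge0_sume_distrl; last by move=> s _; rewrite lee_fin.
  by rewrite lee_wpmul2r// sumEFin sumr_const card_ord natrM mulrC mulr_natr.
rewrite nneseriesZl// EFinM -muleA lee_wpmul2l ?lee_fin//.
by rewrite lee_pdivlMl// sum_first_large.
Qed.

(** Take the first level k <= n at which the average at the changed point is large.
    If k <= t the change does not affect the cylinder of level k, so x itself is
    in first_large l k; otherwise t is one of the d coordinates below k. *)
Lemma shift_coverP l d n t x (r : 'Z_(m t)) : ~ shift_cover l d x ->
  (n <= t + d)%N -> ~ large_avg l n (replace_coord r x).
Proof.
move=> Nx nt /large_avg_first [k kn fk]; apply: Nx.
exists k => //; have [kt|tk] := leqP k t.
  left; rewrite (@level_first_large l k _ (replace_coord r x))// => j jk.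
  by rewrite replace_coord_out//; lia.
right; rewrite -bigcup_seq.
have sd : (k.-1 - t < d)%N by lia.
exists (Ordinal sd) => /=; first exact: mem_index_enum.
by rewrite (_ : (k.-1 - (k.-1 - t))%N = t); [exists r|lia].
Qed.

Lemma shift_coverP0 l d n x : ~ shift_cover l d x -> ~ large_avg l n x.
Proof.
move=> Nx /large_avg_first [k kn fk]; apply: Nx.
by exists k => //; left.
Qed.

End maximal.

(** * The weak type inequality for the majorant kernels *)

Section majorant.
Variables (R : realType) (m : nat -> nat).
Hypothesis m_ge2 : forall k, (2 <= m k)%N.
Variable mu : {measure set (vilenkin m) -> \bar R}.
Hypothesis mu_product : is_product_measure mu.
Variable B : nat.
Hypothesis m_le : forall k, (m k <= B)%N.
Local Notation G := (vilenkin m).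

(** The kernel kappa_l of the introduction as a function on the group: for given t
    at most one r contributes at y, namely the t-th coordinate of y. *)
Definition majorant l (x y : G) : R :=
  (vM m l)%:R * \1_(cell l x) y +
  \sum_(t < l) (vM m t)%:R * \sum_(r : 'Z_(m t)) \1_(cell l (replace_coord r x)) y.

Lemma majorant_ge0 l x y : 0 <= majorant l x y.
Proof.
rewrite addr_ge0 ?mulr_ge0 // sumr_ge0// => t _.
by by rewrite mulr_ge0// sumr_ge0.
Qed.

Lemma measurable_cell_indic l x : measurable_fun setT (\1_(cell l x) : G -> R).
Proof. by apply: measurable_indic; exact: measurable_cell. Qed.

Lemma measurable_majorant l x : measurable_fun setT (majorant l x).
Proof.
apply: measurable_funD.
  by apply: measurable_funM => //; exact: measurable_cell_indic.
apply: measurable_sum => t; apply: measurable_funM => //.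
by apply: measurable_sum => r; exact: measurable_cell_indic.
Qed.

Lemma integral_majorant (g : G -> \bar R) l x :
  measurable_fun setT g -> (forall x, 0 <= g x)%E ->
  (\int[mu]_y (g y * (majorant l x y)%:E) =
   (vM m l)%:R%:E * \int[mu]_(y in cell l x) g y +
   \sum_(t < l) (vM m t)%:R%:E *
     \sum_(r : 'Z_(m t)) \int[mu]_(y in cell l (replace_coord r x)) g y)%E.
Proof.
move=> mg g0.
have mgi z : measurable_fun setT (fun y : G => (g y * (\1_(cell l z) y)%:E)%E).
  by apply: emeasurable_funM => //; apply/measurable_EFinP; exact: measurable_cell_indic.
have gi0 z y : (0 <= g y * (\1_(cell l z) y)%:E)%E.
  by rewrite mule_ge0// lee_fin.
have Ei z : (\int[mu]_(y in cell l z) g y = \int[mu]_y (g y * (\1_(cell l z) y)%:E))%E.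
  by rewrite integral_mkcond epatch_indic.
have -> : (fun y => g y * (majorant l x y)%:E)%E = (fun y =>
   (vM m l)%:R%:E * (g y * (\1_(cell l x) y)%:E) +
   \sum_(t < l) (vM m t)%:R%:E *
     \sum_(r : 'Z_(m t)) (g y * (\1_(cell l (replace_coord r x)) y)%:E))%E.
  apply/funext => y; rewrite /majorant EFinD ge0_muleDr; last 2 first.
  - by rewrite lee_fin mulr_ge0.
  - rewrite lee_fin sumr_ge0// => t _; by rewrite mulr_ge0// sumr_ge0.
  congr (_ + _)%E; first by rewrite EFinM muleCA.
  rewrite -sumEFin ge0_sume_distrr; last first.
    move=> t _; by rewrite lee_fin mulr_ge0// sumr_ge0.
  apply: eq_bigr => t _; rewrite EFinM muleCA; congr (_ * _)%E.
  by rewrite -sumEFin ge0_sume_distrr.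
rewrite ge0_integralD//; first last.
- apply: emeasurable_sum => t; apply: measurable_funeM.
  exact: emeasurable_sum.
- move=> y _; apply: sume_ge0 => t _; rewrite mule_ge0 ?lee_fin//.
  by apply: sume_ge0 => r _.
- exact: measurable_funeM.
- by move=> y _; rewrite mule_ge0 ?lee_fin.
rewrite ge0_integralZl ?lee_fin// -Ei; congr (_ + _)%E.
rewrite ge0_integral_sum//; first last.
- move=> t y _; rewrite mule_ge0 ?lee_fin//.
  by apply: sume_ge0 => r _.
- by move=> t; apply: measurable_funeM; exact: emeasurable_sum.
apply: eq_bigr => t _; rewrite ge0_integralZl ?lee_fin//; first last.
- by move=> y _; apply: sume_ge0 => r _.
- exact: emeasurable_sum.
congr (_ * _)%E; rewrite ge0_integral_sum//.
by apply: eq_bigr => r _; rewrite -Ei.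
Qed.

Lemma vM_expn t l : (t <= l)%N -> (vM m t * 2 ^ (l - t) <= vM m l)%N.
Proof.
move=> tl; rewrite -{2}(subnKC tl); elim: (l - t)%N => [|d IH].
  by rewrite muln1 addn0.
rewrite addnS vMS expnS mulnCA leq_mul//.
Qed.

Lemma sum_geom_3_4 l : \sum_(t < l) (3 / 4 : R) ^+ (l - t) <= 3.
Proof.
elim: l => [|l IH]; first by rewrite big_ord0.
rewrite big_ord_recr /= subSnn expr1.
have -> : \sum_(i < l) (3 / 4 : R) ^+ (l.+1 - i) =
    3 / 4 * \sum_(t < l) (3 / 4 : R) ^+ (l - t).
  by rewrite mulr_sumr; apply: eq_bigr => i _; rewrite subSn ?exprS// ltnW.
lra.
Qed.

Lemma sum_geom_5_6 n : \sum_(i < n) (5 / 6 : R) ^+ i <= 6.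
Proof.
have p : 0 <= (5 / 6 : R) ^+ n by rewrite exprn_ge0//; lra.
have -> : \sum_(i < n) (5 / 6 : R) ^+ i = 6 * (1 - (5 / 6 : R) ^+ n); last lra.
elim: n {p} => [|n IH]; first by rewrite big_ord0 expr0; lra.
rewrite big_ord_recr /= IH exprS; lra.
Qed.

(** The base 3/2 lies strictly between 1, needed for the measures to be summable,
    and 2, the least growth factor of the M_l, needed in integral_majorant_le. *)
Definition exceptional (g : G -> \bar R) (a : R) : set G :=
  \bigcup_d shift_cover mu g (a * (3 / 2) ^+ d) d.

Variable g : G -> \bar R.
Hypothesis mg : measurable_fun setT g.
Hypothesis g0 : forall x, (0 <= g x)%E.

Lemma measurable_exceptional a : measurable (exceptional g a).
Proof. by apply: bigcup_measurable => d _; exact: measurable_shift_cover. Qed.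

(** The cylinders with the t-th coordinate changed have relative weight at most
    2 ^ -(l - t) in the kernel, against averages of at most a (3/2) ^ (l - t): the
    products form a geometric series of ratio 3/4. *)
Lemma integral_majorant_le a l x : 0 < a -> ~ exceptional g a x ->
  (\int[mu]_y (g y * (majorant l x y)%:E) <= (4 * B%:R * a)%:E)%E.
Proof.
move=> a0 Nx; rewrite integral_majorant//.
have Nd d : ~ shift_cover mu g (a * (3 / 2) ^+ d) d x.
  by move=> H; apply: Nx; exists d.
have B1 : 1 <= B%:R :> R.
  by rewrite ler1n; apply: leq_trans (m_le 0); apply: leq_trans (m_ge2 0).
have M0 k : 0 < (vM m k)%:R :> R by rewrite ltr0n vM_gt0.
have -> : 4 * B%:R * a = B%:R * a + B%:R * a * 3 by ring.
rewrite EFinD leeD//.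
  have := @shift_coverP0 _ _ _ _ _ _ l _ (Nd 0%N).
  rewrite /large_avg /= expr0 mulr1 => /negP; rewrite -leNgt => /le_trans; apply.
  by rewrite lee_fin ler_peMl// ltW.
apply: (@le_trans _ _ (\sum_(t < l) (B%:R * a * (3 / 4 : R) ^+ (l - t))%:E)%E); last first.
  rewrite sumEFin lee_fin -mulr_sumr ler_wpM2l// ?sum_geom_3_4//.
  by rewrite mulr_ge0// ltW.
apply: lee_sum => t _.
apply: (@le_trans _ _ ((vM m t)%:R%:E *
   \sum_(r : 'Z_(m t)) ((vM m l)%:R^-1 * (a * (3 / 2) ^+ (l - t)))%:E)%E).
  rewrite lee_wpmul2l ?lee_fin//; apply: lee_sum => r _.
  have ll : (l <= t + (l - t))%N by lia.
  have /negP := @shift_coverP _ _ _ _ _ _ l t _ r (Nd (l - t)%N) ll.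
  by rewrite -leNgt /large_avg/= => H; rewrite EFinM lee_pdivlMl.
rewrite sumEFin sumr_const card_ord Zp_cast// -EFinM lee_fin.
have mB : (m t)%:R <= B%:R :> R by rewrite ler_nat.
have p0 : 0 <= (3 / 2 : R) ^+ (l - t) by rewrite exprn_ge0//; lra.
have : (vM m t)%:R * 2 ^+ (l - t) <= (vM m l)%:R :> R.
  by rewrite -natrX -natrM ler_nat vM_expn// ltnW.
have -> : (3 / 4 : R) ^+ (l - t) = (3 / 2 : R) ^+ (l - t) / 2 ^+ (l - t).
  by rewrite -expr_div_n; congr (_ ^+ _); lra.
have w0 : 0 < 2 ^+ (l - t) :> R by rewrite exprn_gt0.
move: (2 ^+ (l - t)) w0 ((3 / 2) ^+ _) p0 => w w0 p p0 wl.
rewrite -mulr_natr [leLHS](_ : _ =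
  ((m t)%:R * a * p) * ((vM m t)%:R / (vM m l)%:R)); last by ring.
rewrite [leRHS](_ : _ = (B%:R * a * p) / w); last by ring.
apply: ler_pM; rewrite ?mulr_ge0 ?divr_ge0//; [exact: ltW|..].
  by rewrite -!mulrA ler_wpM2r// mulr_ge0// ltW.
by rewrite ler_pdivrMr// mulrC ler_pdivlMr.
Qed.

(** The d-th cover costs (1 + d B) (2/3) ^ d times the integral of g over a, and
    1 + d <= 4 (5/4) ^ d turns these factors into a geometric series of ratio
    5/6. *)
Lemma mu_exceptional_le a : 0 < a ->
  (mu (exceptional g a) <= (24 * B%:R / a)%:E * \int[mu]_x g x)%E.
Proof.
move=> a0; set I := (\int[mu]_x g x)%E.
have I0 : (0 <= I)%E by exact: integral_ge0.
have B1 : 1 <= B%:R :> R.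
  by rewrite ler1n; apply: leq_trans (m_le 0); apply: leq_trans (m_ge2 0).
have p0 d : 0 < (3 / 2 : R) ^+ d by rewrite exprn_gt0//; lra.
apply: (@le_trans _ _ (\sum_(d <oo) mu (shift_cover mu g (a * (3 / 2) ^+ d) d))%E).
  apply: measure_sigma_subadditive => //; last exact: measurable_exceptional.
  by move=> d; exact: measurable_shift_cover.
apply: lime_le; first by apply: is_cvg_nneseries => n _ _; exact: measure_ge0.
near=> N.
apply: (@le_trans _ _ (\sum_(0 <= d < N) (4 * B%:R / a * (5 / 6) ^+ d)%:E * I)%E).
  apply: lee_sum => d _.
  rewrite (le_trans (mu_shift_cover_le m_ge2 mu_product m_le mg g0 _ _))//.
    by rewrite mulr_gt0.
  rewrite lee_wpmul2r// lee_fin.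
  have H4 : (4 + d%:R : R) <= 4 * (5 / 4) ^+ d.
    elim: d => [|d IH]; first by rewrite expr0; lra.
    rewrite exprS -[d.+1%:R]natr1; have : 0 <= d%:R :> R by []. lra.
  have H : (1 + d%:R : R) <= 4 * (5 / 4) ^+ d by lra.
  have -> : (5 / 6 : R) ^+ d = (5 / 4) ^+ d / (3 / 2) ^+ d.
    by rewrite -expr_div_n; congr (_ ^+ _); lra.
  rewrite invfM mulrA [leRHS](_ : _ = (4 * (5 / 4) ^+ d * B%:R) / a / (3 / 2) ^+ d); last by ring.
  rewrite ler_wpM2r ?invr_ge0 ?(ltW (p0 _))// ler_wpM2r ?invr_ge0 ?(ltW a0)//.
  rewrite natrD natrM (le_trans _ (ler_wpM2r _ H))// mulrDl mul1r lerD2r//.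
rewrite -ge0_sume_distrl; last first.
  by move=> d _; rewrite lee_fin !mulr_ge0 ?invr_ge0 ?exprn_ge0 ?(ltW a0)//; lra.
rewrite lee_wpmul2r// sumEFin lee_fin -mulr_sumr.
rewrite [leRHS](_ : _ = 4 * B%:R / a * 6); last by ring.
rewrite ler_wpM2l ?mulr_ge0 ?invr_ge0 ?(ltW a0)//.
by rewrite big_mkord sum_geom_5_6.
Unshelve. all: by end_near. Qed.

End majorant.

(** * Density of the functions of finitely many coordinates *)

Lemma cvge0_le (R : realType) (u : (\bar R)^nat) (e : R) :
  u n @[n --> \oo] --> (0 : \bar R)%E -> 0 < e -> exists n, (u n <= e%:E)%E.
Proof.
move=> /fine_cvgP[ufin /cvgrPdist_le /(_ _ _)/[swap] e0 /(_ _ e0) ue].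
have [n [un1 un2]] : exists n, u n \is a fin_num /\ `|0 - fine (u n)| <= e.
  by have [n _ /(_ n (leqnn n))] := filterI ufin ue; exists n.
exists n; rewrite -(fineK un1) lee_fin; move: un2; rewrite sub0r normrN.
exact: le_trans (ler_norm _).
Qed.

Section density.
Import HBSimple.
Variables (R : realType) (m : nat -> nat).
Hypothesis m_ge2 : forall k, (2 <= m k)%N.
Variable mu : {measure set (vilenkin m) -> \bar R}.
Hypothesis mu_product : is_product_measure mu.
Local Notation G := (vilenkin m).

Lemma of_levelW n n' T (h : G -> T) : (n <= n')%N -> of_level n h -> of_level n' h.
Proof. by move=> nn' hn x y xy; apply: hn => k kn; apply: xy; exact: leq_trans nn'. Qed.

Lemma level_measurable_fun n (h : G -> R) : of_level n h -> measurable_fun setT h.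
Proof.
move=> hn _ Y _; rewrite setTI; apply: (level_measurable m_ge2 (n := n)).
by move=> x y xy; rewrite /preimage/= (hn x y xy).
Qed.

Lemma level_bounded n (h : G -> R) : of_level n h ->
  exists2 K, 0 <= K & forall x, `|h x| <= K.
Proof.
move=> hn; exists (\sum_(c < vM m n) `|h (digit_point m c)|); first exact: sumr_ge0.
move=> x; have [c cM cx] := digit_point_exists m_ge2 n x.
rewrite -(hn _ _ cx) (bigD1 (Ordinal cM))//= lerDl; exact: sumr_ge0.
Qed.

(** Approximation in measure by cylindrical sets.  The error is recorded by a set D
    outside which A and C coincide, so that errors are combined by unions. *)
Definition level_approx (A : set G) := measurable A /\
  forall e : R, 0 < e -> exists n C D,
    [/\ @of_level m n Prop C, measurable D, (mu D <= e%:E)%E &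
        forall x, ~ D x -> (A x <-> C x)].

Lemma level_approx_level n (A : set G) : of_level n A -> level_approx A.
Proof.
move=> An; split; first exact: (level_measurable m_ge2 An).
by move=> e e0; exists n, A, set0; split => //; rewrite measure0 lee_fin ltW.
Qed.

Lemma level_approxC (A : set G) : level_approx A -> level_approx (~` A).
Proof.
move=> [mA H]; split; first exact: measurableC.
move=> e /H[n [C [D [nC mD De AC]]]]; exists n, (~` C), D; split => //.
  by move=> x y xy; rewrite /setC/= (nC x y xy).
by move=> x /AC[H1 H2]; split => nH; [move=> /H2|move=> /H1].
Qed.

Lemma level_approxU (A A' : set G) :
  level_approx A -> level_approx A' -> level_approx (A `|` A').
Proof.
move=> [mA H] [mA' H']; split; first exact: measurableU.
move=> e e0; have e2 : 0 < e / 2 by rewrite divr_gt0.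
have [n [C [D [nC mD De AC]]]] := H _ e2.
have [n' [C' [D' [nC' mD' De' AC']]]] := H' _ e2.
exists (maxn n n'), (C `|` C'), (D `|` D'); split.
- move=> x y xy; rewrite /setU/=.
  by rewrite (of_levelW (leq_maxl n n') nC xy) (of_levelW (leq_maxr n n') nC' xy).
- exact: measurableU.
- rewrite (le_trans (measureU2 _ _ _))//.
  by rewrite (splitr e) EFinD leeD.
- move=> x /not_orP[nD nD'].
  by split=> -[/AC|/AC'] h; [left|right|left|right]; exact: h.
Qed.

(** Finite unions are approximable, and by continuity of the measure they exhaust
    the countable union up to a set of small measure. *)
Lemma level_approx_bigcup (A : (set G)^nat) :
  (forall n, level_approx (A n)) -> level_approx (\bigcup_n A n).
Proof.
move=> HA; have mA n : measurable (A n) by have [] := HA n.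
have mUA : measurable (\bigcup_n A n) by exact: bigcup_measurable.
split => // e e0; have e2 : 0 < e / 2 by rewrite divr_gt0.
pose U n := \big[setU/set0]_(i < n) A i.
have mU n : measurable (U n) by exact: bigsetU_measurable.
pose F n := \bigcup_n A n `\` U n.
have mF n : measurable (F n) by exact: measurableD.
have F0 : \bigcap_n F n = set0.
  rewrite -subset0 => x HF; have [[k _ Ak] _] := HF 0%N I.
  have [_] := HF k.+1 I; apply; rewrite /U -bigcup_mkord.
  by exists k => /=.
have cF : mu (F n) @[n --> \oo] --> (0 : \bar R)%E.
  rewrite -(measure0 mu) -F0; apply: nonincreasing_cvg_mu => //.
  - rewrite (@le_lt_trans _ _ (mu setT))//; last by rewrite (mu_setT mu_product) ltry.
    by apply: le_measure; rewrite ?inE.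
  - by rewrite F0.
  - move=> i j ij; apply/subsetPset => x [Ax Ux]; split => //.
    move: Ux; rewrite /U -!bigcup_mkord => H -[k /= ki Ak]; apply: H.
    by exists k => //=; rewrite (leq_trans ki).
have [n Hn] := cvge0_le cF e2.
have UA : forall k, level_approx (U k).
  elim=> [|k IH]; rewrite /U ?big_ord0 ?big_ord_recr/=.
    exact: (@level_approx_level 0).
  exact: level_approxU.
have [_ /(_ _ e2)[N [C [D [nC mD De AC]]]]] := UA n.
exists N, C, (D `|` F n); split => //; first exact: measurableU.
  rewrite (le_trans (measureU2 _ _ _))//.
  by rewrite (splitr e) EFinD leeD.
move=> x /not_orP[nD nF]; rewrite -AC//; split => [Ax|].
  by apply: contrapT => nU; exact: nF.
by rewrite /U -bigcup_mkord => -[k _ Ak]; exists k.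
Qed.

(** The approximable sets form a sigma-algebra that contains the generators. *)
Lemma level_approx_measurable (A : set G) : measurable A -> level_approx A.
Proof.
apply: (@smallest_sub _ (sigma_algebra setT) (@vilenkin_cylinder m) level_approx).
  split; first exact: (@level_approx_level 0).
    by move=> C HC; rewrite setTD; exact: level_approxC.
  exact: level_approx_bigcup.
move=> _ [k [A' ->]]; apply: (@level_approx_level k.+1) => x y xy.
by rewrite /= xy.
Qed.

Definition L1_approx (h : G -> R) := measurable_fun setT h /\
  forall e : R, 0 < e -> exists n phi, of_level n phi /\
    (\int[mu]_x `|h x - phi x|%:E <= e%:E)%E.

Lemma L1_approx_trans (h : G -> R) : measurable_fun setT h ->
  (forall e : R, 0 < e -> exists h', L1_approx h' /\
    (\int[mu]_x `|h x - h' x|%:E <= e%:E)%E) -> L1_approx h.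
Proof.
move=> mh H; split => // e e0; have e2 : 0 < e / 2 by rewrite divr_gt0.
have [h' [[mh' /(_ _ e2) [n [phi [nphi Hphi]]]] Hh']] := H _ e2.
have mphi := level_measurable_fun nphi.
exists n, phi; split => //.
apply: (@le_trans _ _ (\int[mu]_x (`|h x - h' x|%:E + `|h' x - phi x|%:E))%E).
  apply: ge0_le_integral => //.
  - by apply/measurable_EFinP; apply: measurableT_comp => //; exact: measurable_funB.
  - apply: emeasurable_funD; apply/measurable_EFinP;
      apply: measurableT_comp => //; exact: measurable_funB.
  - by move=> x _; rewrite -EFinD lee_fin (le_trans _ (ler_normD _ _))// addrA subrK.
rewrite ge0_integralD//; first by rewrite (splitr e) EFinD leeD.
all: by apply/measurable_EFinP; apply: measurableT_comp => //; exact: measurable_funB.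
Qed.

Lemma L1_approxD (h h' : G -> R) : L1_approx h -> L1_approx h' ->
  L1_approx (fun x => h x + h' x).
Proof.
move=> [mh H] [mh' H']; split; first exact: measurable_funD.
move=> e e0; have e2 : 0 < e / 2 by rewrite divr_gt0.
have [n [phi [nphi Hphi]]] := H _ e2.
have [n' [phi' [nphi' Hphi']]] := H' _ e2.
have mphi := level_measurable_fun nphi; have mphi' := level_measurable_fun nphi'.
exists (maxn n n'), (fun x => phi x + phi' x); split.
  move=> x y xy.
  by rewrite (of_levelW (leq_maxl n n') nphi xy) (of_levelW (leq_maxr n n') nphi' xy).
apply: (@le_trans _ _ (\int[mu]_x (`|h x - phi x|%:E + `|h' x - phi' x|%:E))%E).
  apply: ge0_le_integral => //.
  - apply/measurable_EFinP; apply: measurableT_comp => //.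
    by apply: measurable_funB; exact: measurable_funD.
  - apply: emeasurable_funD; apply/measurable_EFinP;
      apply: measurableT_comp => //; exact: measurable_funB.
  - move=> x _; rewrite -EFinD lee_fin (le_trans _ (ler_normD _ _))//.
    by rewrite opprD addrACA.
rewrite ge0_integralD//; first by rewrite (splitr e) EFinD leeD.
all: by apply/measurable_EFinP; apply: measurableT_comp => //; exact: measurable_funB.
Qed.

Lemma L1_approx_indic (v : R) (A : set G) : measurable A ->
  L1_approx (fun x => v * \1_A x).
Proof.
move=> mA; have mvA : measurable_fun setT (fun x => v * \1_A x : R).
  by apply: measurable_funM => //; exact: measurable_indic.
split => // e e0.
(* v may be 0, so the tolerance is divided by |v| + 1 *)
have v0 : 0 < `|v| + 1 by rewrite ltr_wpDl.
have ev : 0 < e / (`|v| + 1) by rewrite divr_gt0.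
have [_ /(_ _ ev)[n [C [D [nC mD De AC]]]]] := level_approx_measurable mA.
have nphi : of_level n (fun x => v * \1_C x : R).
  by move=> x y xy; rewrite !indicE /in_mem/= /in_set (nC x y xy).
have mphi := level_measurable_fun nphi.
exists n, (fun x => v * \1_C x); split => //.
apply: (@le_trans _ _ (\int[mu]_x ((`|v| + 1)%:E * (\1_D x)%:E))%E).
  apply: ge0_le_integral => //.
  - by apply/measurable_EFinP; apply: measurableT_comp => //; exact: measurable_funB.
  - by apply: measurable_funeM; apply/measurable_EFinP; exact: measurable_indic.
  - move=> x _; rewrite -EFinM lee_fin -mulrBr normrM.
    have [Dx|nDx] := pselect (D x).
      rewrite [X in _ <= _ * X]indicE mem_set// mulr1.
      apply: (@le_trans _ _ (`|v| * 1)); last by rewrite mulr1 lerDl.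
      rewrite ler_wpM2l// !indicE.
      by case: (x \in A); case: (x \in (C : set G));
        rewrite ?subrr ?subr0 ?sub0r ?normrN ?normr1 ?normr0.
    have -> : \1_A x = \1_C x :> R.
      rewrite !indicE; congr (_%:R); congr nat_of_bool.
      by apply/idP/idP; rewrite !inE => /AC; apply.
    by rewrite subrr normr0 mulr0 mulr_ge0// ltW.
rewrite ge0_integralZl ?lee_fin ?(ltW v0)//; last first.
  by apply/measurable_EFinP; exact: measurable_indic.
by rewrite integral_indic// setIT -lee_pdivlMl// -EFinM mulrC.
Qed.

(** Simple functions are dense in L1, and each level set of a simple function is
    approximable by cylindrical sets. *)
Lemma L1_approx_integrable (u : G -> R) :
  mu.-integrable setT (EFin \o u) -> L1_approx u.
Proof.
move=> iu; have mu' : measurable_fun setT u.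
  by apply/measurable_EFinP; exact: measurable_int iu.
apply: L1_approx_trans => // e e0.
have [s [_ _ Hs]] := approximation_sfun_integrable measurableT iu.
have [n Hn] := cvge0_le Hs e0.
exists (s n); split; last exact: Hn.
have -> : (s n : G -> R) = (fun x : G =>
    \sum_(y <- finmap.enum_fset (fset_set (range (s n)))) y * \1_(s n @^-1` [set y]) x).
  by apply/funext => x; rewrite {1}fimfunE fsbig_finite.
elim: (finmap.enum_fset _) => [|y r IH].
  under eq_fun do rewrite big_nil.
  split => // d d0; exists 0%N, (fun=> 0); split => //.
  under eq_integral do rewrite subrr normr0.
  by rewrite integral0 lee_fin ltW.
under eq_fun do rewrite big_cons.
by apply: L1_approxD => //; exact: L1_approx_indic.
Qed.

End density.

(** * Almost everywhere decay of the weighted oscillation *)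

Section oscillation.
Variables (R : realType) (m : nat -> nat).
Hypothesis m_ge2 : forall k, (2 <= m k)%N.
Variable mu : {measure set (vilenkin m) -> \bar R}.
Hypothesis mu_product : is_product_measure mu.
Variable B : nat.
Hypothesis m_le : forall k, (m k <= B)%N.
Local Notation G := (vilenkin m).

Lemma level_majorant l (x : G) : of_level l (majorant R l x).
Proof.
have H (z y y' : G) : (forall k, (k < l)%N -> y k = y' k) ->
    \1_(cell l z) y = \1_(cell l z) y' :> R.
  move=> yy'; rewrite !indicE; congr (_%:R); congr nat_of_bool.
  by apply/idP/idP; rewrite !inE => H k kl; rewrite -(H k kl) yy'.
move=> y y' yy'; rewrite /majorant (H _ _ _ yy'); congr (_ + _).
apply: eq_bigr => t _; congr (_ * _); apply: eq_bigr => r _; exact: H.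
Qed.

Lemma sum_vM l : (\sum_(t < l) vM m t * m t <= 2 * vM m l)%N.
Proof.
elim: l => [|l IH]; first by rewrite big_ord0.
rewrite big_ord_recr /= vMS [(vM m l * _)%N]mulnC.
have : (2 * vM m l <= m l * vM m l)%N by rewrite leq_mul2r m_ge2 orbT.
move: IH; move: (\sum_(t < l) _)%N => S. lia.
Qed.

(** The weight M_t of the t-th term and the m_t values of r give M_(t + 1) / M_l, and
    the M_t grow at least geometrically with ratio 2. *)
Lemma integral_majorant_1 l (x : G) : (\int[mu]_y (majorant R l x y)%:E <= 3%:E)%E.
Proof.
have M0 : 0 < (vM m l)%:R :> R by rewrite ltr0n vM_gt0.
have := @integral_majorant R m mu (fun=> 1%E) l x.
under eq_integral do rewrite mul1e.
move=> ->//; rewrite integral_cst ?mul1e ?mu_cell//; last exact: measurable_cell.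
under eq_bigr => t _.
  under eq_bigr => r _.
    rewrite integral_cst; last exact: measurable_cell.
    rewrite mul1e mu_cell//; over.
  rewrite sumEFin sumr_const card_ord Zp_cast// -EFinM; over.
rewrite sumEFin -EFinM -EFinD lee_fin divff ?gt_eqF//.
under eq_bigr do rewrite -[_ *+ m _]mulr_natr mulrCA mulrC -natrM.
rewrite -mulr_suml -natr_sum.
have -> : 3 = 1 + 2 :> R by lra.
by rewrite lerD2l ler_pdivrMr// -natrM ler_nat sum_vM.
Qed.

(** Only the terms t < N of the kernel see a change of phi, since the others fix the
    first N coordinates; their total mass is at most 2 M_N / M_l. *)
Lemma integral_majorant_level N (phi : G -> R) (K : R) l (x : G) :
  of_level N phi -> (N <= l)%N ->
  (forall y, `|phi y| <= K) ->
  (\int[mu]_y (`|phi y - phi x| * majorant R l x y)%:E <=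
    (4 * K * (vM m N)%:R / (vM m l)%:R)%:E)%E.
Proof.
move=> Nphi Nl phiK.
have M0 : 0 < (vM m l)%:R :> R by rewrite ltr0n vM_gt0.
have mphi := level_measurable_fun m_ge2 Nphi.
under eq_integral do rewrite EFinM.
rewrite integral_majorant//; last first.
  by apply/measurable_EFinP; apply: measurableT_comp => //; exact: measurable_funB.
rewrite integral0_eq ?mule0 ?add0e; last first.
  move=> y yx; rewrite (Nphi y x) ?subrr ?normr0// => k kN.
  by rewrite yx// (leq_trans kN).
rewrite (bigID (fun t : 'I_l => (t < N)%N))/= [X in (_ + X)%E]big1 ?adde0; last first.
  move=> t tN; rewrite big1 ?mule0// => r _; rewrite integral0_eq// => y yx.
  rewrite (Nphi y x) ?subrr ?normr0// => k kN.
  by rewrite yx ?(leq_trans kN)// replace_coord_out//; lia.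
apply: (@le_trans _ _ (\sum_(t < l | (t < N)%N)
    ((vM m t * m t)%:R * (2 * K / (vM m l)%:R))%:E)%E).
  apply: lee_sum => t tN; rewrite natrM -mulrA EFinM lee_wpmul2l ?lee_fin//.
  have -> : (m t)%:R * (2 * K / (vM m l)%:R) =
      \sum_(r : 'Z_(m t)) (2 * K / (vM m l)%:R) :> R.
    by rewrite sumr_const card_ord Zp_cast// mulr_natl.
  rewrite -sumEFin; apply: lee_sum => r _.
  rewrite EFinM -(mu_cell mu_product l (replace_coord r x)).
  rewrite -integral_cst; last exact: measurable_cell.
  apply: ge0_le_integral => //; first exact: measurable_cell.
    apply/measurable_EFinP; apply: measurableT_comp => //.
    by apply: measurable_funTS; exact: measurable_funB.
  move=> y _; rewrite lee_fin (le_trans (ler_normB _ _))//.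
  by have := phiK x; have := phiK y; lra.
rewrite sumEFin lee_fin -mulr_suml -natr_sum -(big_ord_widen l (fun t => (vM m t * m t)%N))//.
have -> : 4 * K * (vM m N)%:R / (vM m l)%:R = (2 * vM m N)%:R * (2 * K / (vM m l)%:R) :> R.
  by rewrite natrM; field; rewrite gt_eqF.
have K0 : 0 <= K by exact: le_trans (phiK x).
by rewrite ler_wpM2r ?ler_nat ?sum_vM// !mulr_ge0// invr_ge0 ltW.
Qed.

Definition osc (u : G -> R) l x : \bar R :=
  (\int[mu]_y (`|u y - u x| * majorant R l x y)%:E)%E.

Lemma osc_ge0 u l x : (0 <= osc u l x)%E.
Proof. by apply: integral_ge0 => y _; rewrite lee_fin mulr_ge0// majorant_ge0. Qed.

(** Approximate u in L1 by phi of finite level.  Off an exceptional set for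
    g = |u - phi|, of measure controlled by the integral of g, the contributions
    of g(y) and g(x) are small at all levels, and that of phi at large levels. *)
Lemma osc_small (u : G -> R) (a e : R) : mu.-integrable setT (EFin \o u) ->
  0 < a -> 0 < e ->
  exists U, [/\ measurable U, (mu U <= e%:E)%E &
    forall x, ~ U x -> exists L, forall l, (L <= l)%N ->
      (osc u l x <= ((4 * B%:R + 4) * a)%:E)%E].
Proof.
move=> iu a0 e0.
have [mu' /(_ (e * a / (24 * B%:R + 1)))[]] := L1_approx_integrable m_ge2 mu_product iu.
  by rewrite divr_gt0 ?mulr_gt0// ltr_wpDl// mulr_ge0.
move=> N [phi [Nphi Hphi]].
have mphi := level_measurable_fun m_ge2 Nphi.
have [K K0 phiK] := level_bounded m_ge2 Nphi.
pose g y := `|u y - phi y|.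
have mg : measurable_fun setT g.
  by apply: measurableT_comp => //; exact: measurable_funB.
have mgE : measurable_fun setT (EFin \o g) by exact/measurable_EFinP.
have g0 y : (0 <= (g y)%:E)%E by rewrite lee_fin /g.
have mD : measurable [set x | a <= g x].
  rewrite (_ : [set x | _] = g @^-1` `[a, +oo[%classic).
    by rewrite -[X in measurable X]setTI; exact: mg.
  by apply/seteqP; split => x; rewrite /preimage/= in_itv/= andbT.
have mX : measurable (exceptional mu (EFin \o g) a) by exact: measurable_exceptional.
exists (exceptional mu (EFin \o g) a `|` [set x | a <= g x]); split.
- exact: measurableU.
- rewrite (le_trans (measureU2 _ _ _))//.
  have B1 : 0 < 24 * B%:R + 1 :> R by rewrite ltr_wpDl// mulr_ge0.
  (* delta = e a / (24 B + 1) bounds the L1 distance of u and phi; the two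
     parts of the exceptional set have measures at most 24 B delta / a and
     delta / a *)
  have -> : e = (24 * B%:R / a) * (e * a / (24 * B%:R + 1)) +
      a^-1 * (e * a / (24 * B%:R + 1)).
    by field; rewrite !gt_eqF.
  rewrite EFinD leeD//.
    rewrite (le_trans (mu_exceptional_le m_ge2 mu_product m_le mgE g0 a0))//.
    rewrite [leRHS]EFinM lee_wpmul2l// lee_fin divr_ge0 ?mulr_ge0//; exact: ltW.
  rewrite EFinM lee_pdivlMl//; apply: le_trans Hphi.
  have := le_integral_abse mu measurableT mgE a0; rewrite setTI.
  rewrite (_ : (\int[mu]_x `|(EFin \o g) x|)%E = (\int[mu]_x (g x)%:E)%E); last first.
    by apply: eq_integral => y _; rewrite gee0_abs//; exact: g0.
  apply: le_trans; rewrite lee_wpmul2l ?lee_fin ?(ltW a0)//.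
  rewrite (_ : [set x | a <= g x] = [set x | (a%:E <= `|(EFin \o g) x|)%E])//.
  by apply/seteqP; split => x /=; rewrite lee_fin ger0_norm// normr_ge0.
- move=> x /not_orP[Nx /negP]; rewrite -ltNge => gx.
  (* the contribution of phi is at most 4 K M_N / M_l, and l < M_l *)
  pose L := maxn N (Num.Def.trunc (4 * K * (vM m N)%:R / a)).+1.
  exists L => l Ll.
  have Nl : (N <= l)%N by rewrite (leq_trans _ Ll)// leq_maxl.
  have M0 : 0 < (vM m l)%:R :> R by rewrite ltr0n vM_gt0.
  have lM : 4 * K * (vM m N)%:R / (vM m l)%:R <= a.
    rewrite ler_pdivrMr// [leRHS]mulrC -ler_pdivrMr//.
    rewrite (@le_trans _ _ (Num.Def.trunc (4 * K * (vM m N)%:R / a)).+1%:R)//.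
      by apply: ltW; exact: truncnS_gt.
    rewrite ler_nat (leq_trans _ (ltnW (vM_gt l m_ge2)))//.
    by rewrite (leq_trans _ Ll)// leq_maxr.
  have mP : measurable_fun setT (EFin \o majorant R l x).
    by apply/measurable_EFinP; exact: measurable_majorant.
  have P0 y : (0 <= (majorant R l x y)%:E)%E by rewrite lee_fin majorant_ge0.
  have m1 : measurable_fun setT (fun y => (g y)%:E * (majorant R l x y)%:E)%E.
    exact: emeasurable_funM.
  have m2 : measurable_fun setT (fun y => (g x)%:E * (majorant R l x y)%:E)%E.
    exact: measurable_funeM.
  have m3 : measurable_fun setT (fun y => (`|phi y - phi x| * majorant R l x y)%:E).
    apply/measurable_EFinP; apply: measurable_funM; last exact: measurable_majorant.
    by apply: measurableT_comp => //; exact: measurable_funB.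
  apply: (@le_trans _ _ (\int[mu]_y ((g y)%:E * (majorant R l x y)%:E +
      ((g x)%:E * (majorant R l x y)%:E + (`|phi y - phi x| * majorant R l x y)%:E)))%E).
    apply: ge0_le_integral => //.
    + by move=> y _; rewrite lee_fin mulr_ge0// majorant_ge0.
    + apply/measurable_EFinP; apply: measurable_funM; last exact: measurable_majorant.
      by apply: measurableT_comp => //; exact: measurable_funB.
    + by apply: emeasurable_funD => //; exact: emeasurable_funD.
    + move=> y _; rewrite -!EFinM -!EFinD lee_fin -!mulrDl ler_wpM2r ?majorant_ge0//.
      have -> : u y - u x = (u y - phi y) - (u x - phi x) + (phi y - phi x) by ring.
      by rewrite [leRHS]addrA (le_trans (ler_normD _ _))// lerD2r ler_normB.
  rewrite ge0_integralD//; first last.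
  + exact: emeasurable_funD.
  + by move=> y _; rewrite adde_ge0 ?mule_ge0// lee_fin mulr_ge0// majorant_ge0.
  + by move=> y _; rewrite mule_ge0.
  rewrite ge0_integralD//; first last.
  + by move=> y _; rewrite lee_fin mulr_ge0// majorant_ge0.
  + by move=> y _; rewrite mule_ge0.
  rewrite ge0_integralZl//.
  have -> : (4 * B%:R + 4) * a = 4 * B%:R * a + (a * 3 + a) by ring.
  rewrite !EFinD leeD//; first exact: integral_majorant_le.
  rewrite leeD//; last first.
    by rewrite (le_trans (integral_majorant_level x Nphi Nl phiK))// lee_fin.
  rewrite EFinM (@le_trans _ _ ((g x)%:E * 3%:E)%E)//.
    by rewrite lee_wpmul2l// integral_majorant_1.
  by rewrite lee_wpmul2r ?lee_fin// ltW.
Qed.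

Lemma osc_lty (u : G -> R) l x : mu.-integrable setT (EFin \o u) ->
  (osc u l x < +oo)%E.
Proof.
move=> iu; have mu' : measurable_fun setT u.
  by apply/measurable_EFinP; exact: measurable_int iu.
have [K K0 HK] := level_bounded m_ge2 (@level_majorant l x).
have iu' : mu.-integrable setT (fun y => (u y - u x)%:E).
  under eq_fun do rewrite EFinB.
  apply: integrableB => //.
  apply: (@measurable_bounded_integrable _ _ _ _ (fun=> u x)) => //.
    by rewrite (mu_setT mu_product) ltry.
  by exists (`|u x|); split => // M HM y _ /=; exact: ltW.
have : mu.-integrable setT ((fun y => (u y - u x)%:E) \* (EFin \o majorant R l x))%E.
  apply: integrableMl => //; first exact: measurable_majorant.
  by exists K; split => [|M HM y _]; [exact: ger0_real|exact: le_trans (HK y) (ltW HM)].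
move=> /integrableP[_]; apply: le_lt_trans.
rewrite /osc le_eqVlt; apply/orP; left; apply/eqP; apply: eq_integral => y _.
by rewrite /= normrM (ger0_norm (majorant_ge0 R l x y)).
Qed.

Lemma osc_cvg (u : G -> R) : mu.-integrable setT (EFin \o u) ->
  {ae mu, forall x, (fun l => fine (osc u l x)) @ \oo --> (0 : R)}.
Proof.
move=> iu.
have H k : mu.-negligible [set x | ~ exists L, forall l, (L <= l)%N ->
    (osc u l x <= (k.+1%:R^-1)%:E)%E].
  have a0 : 0 < k.+1%:R^-1 / (4 * B%:R + 4) :> R.
    by rewrite divr_gt0// ltr_wpDl// mulr_ge0.
  have /choice[U HU] : forall j : nat, exists U, [/\ measurable U,
      (mu U <= (j.+1%:R^-1)%:E)%E &
      forall x, ~ U x -> exists L, forall l, (L <= l)%N ->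
      (osc u l x <= (k.+1%:R^-1)%:E)%E].
    move=> j; have [U [mU Uj HU]] := osc_small iu a0 (ltac:(by []) : 0 < j.+1%:R^-1 :> R).
    exists U; split => // x /HU[L HL]; exists L => l /HL.
    by rewrite mulrC divfK// gt_eqF// ltr_wpDl// mulr_ge0.
  (* for the fixed tolerance the exceptional sets U j have measure at most
     1 / (j + 1), so that their intersection is a null set *)
  exists (\bigcap_j U j); split.
  - by apply: bigcapT_measurable => j; have [] := HU j.
  - apply/eqP; rewrite eq_le measure_ge0 andbT; apply/lee_addgt0Pr => e e0.
    rewrite add0e.
    apply: (@le_trans _ _ ((Num.Def.trunc e^-1).+1%:R^-1)%:E).
      have [mUj Uj _] := HU (Num.Def.trunc e^-1); apply: le_trans Uj.
      apply: le_measure; rewrite ?inE//; last exact: bigcap_inf.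
      by apply: bigcapT_measurable => j; have [] := HU j.
    by rewrite lee_fin invf_ple ?posrE//; apply: ltW; exact: truncnS_gt.
  - by move=> x nx j _; apply: contrapT => nU; apply: nx; have [_ _ /(_ x nU)] := HU j.
apply: negligibleS (negligible_bigcup H) => x /= nx.
apply: contrapT => nH; apply: nx; apply/cvgrPdist_le => e e0.
have [L HL] : exists L, forall l, (L <= l)%N ->
    (osc u l x <= ((Num.Def.trunc e^-1).+1%:R^-1)%:E)%E.
  by apply: contrapT => h; apply: nH; exists (Num.Def.trunc e^-1).
exists L => // l /= /HL Hl; rewrite sub0r normrN ger0_norm ?fine_ge0 ?osc_ge0//.
rewrite -lee_fin fineK; last by rewrite ge0_fin_numE ?osc_ge0// osc_lty.
by rewrite (le_trans Hl)// lee_fin invf_ple ?posrE//; apply: ltW; exact: truncnS_gt.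
Qed.

End oscillation.

(** * Characters *)

Section cis.
Local Open Scope complex_scope.
Variable R : realType.

Definition cis (t : R) : R[i] := cos t +i* sin t.

Lemma cisD a b : cis (a + b) = cis a * cis b.
Proof.
rewrite /cis sinD cosD; apply/eqP; rewrite eq_complex /= eqxx/=.
by apply/eqP; ring.
Qed.

Lemma cis0 : cis 0 = 1.
Proof. by rewrite /cis cos0 sin0. Qed.

Lemma cisX a n : cis (n%:R * a) = cis a ^+ n.
Proof.
elim: n => [|n IH]; first by rewrite mul0r cis0 expr0.
by rewrite exprS -IH -natr1 mulrDl mul1r addrC cisD.
Qed.

Lemma cis2pi : cis (2 * pi) = 1.
Proof. by rewrite /cis mulr_natl cos2pi sin2pi. Qed.

Lemma conj_cis a : ((cis a)^*)%R = cis (- a).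
Proof. by rewrite /cis /= cosN sinN. Qed.

(** The half-angle formula cos t = 1 - 2 sin (|t| / 2) ^ 2 applies, where
    0 < |t| / 2 < pi unless t = 0. *)
Lemma cis_eq1 t : `|t| < 2 * pi -> cis t = 1 -> t = 0.
Proof.
move=> tpi [c1 _]; apply: contrapT => /eqP t0.
have p0 : 0 < `|t| / 2 by rewrite divr_gt0// normr_gt0.
have : 0 < sin (`|t| / 2) by apply: sin_gt0_pi; rewrite p0/=; lra.
have : cos t = 1 - 2 * sin (`|t| / 2) ^+ 2.
  rewrite -cos_norm [in LHS](_ : `|t| = (`|t| / 2) *+ 2); last by rewrite -mulr_natr divfK.
  by rewrite cos_mulr2n cos2sin2 -mulr_natr; ring.
by rewrite c1 => H s0; have := exprn_gt0 2 s0; lra.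
Qed.

End cis.

Section characters.
Local Open Scope complex_scope.
Variables (R : realType) (m : nat -> nat).
Hypothesis m_ge2 : forall k, (2 <= m k)%N.
Local Notation G := (vilenkin m).

Let m0 k : (m k)%:R != 0 :> R.
Proof. by rewrite pnatr_eq0; have := m_ge2 k; case: (m k). Qed.

Lemma rademacherE k (x : G) :
  rademacher R k x = cis (2 * pi / (m k)%:R) ^+ x k.
Proof.
rewrite -cisX /rademacher /cis.
by rewrite (_ : 2 * pi * _ / _ = (x k)%:R * (2 * pi / (m k)%:R))//; ring.
Qed.

Lemma cis_root k : cis (2 * pi / (m k)%:R : R) ^+ m k = 1.
Proof. by rewrite -cisX mulrC divfK// cis2pi. Qed.

(** The argument z of the kernels of the first part: the Dirichlet kernel depends on
    x and y only through these ratios. *)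
Definition char_ratio (x y : G) k : R[i] := rademacher R k x * (rademacher R k y)^*.

Lemma ratio_root x y k : char_ratio x y k ^+ m k = 1.
Proof.
rewrite exprMn -rmorphXn/= !rademacherE -!exprM ![(_ * m k)%N]mulnC !exprM.
by rewrite cis_root !expr1n rmorph1 mulr1.
Qed.

Lemma coord_lt k (x : G) : (x k < m k)%N.
Proof. by have := ltn_ord (x k); rewrite {2}Zp_cast. Qed.

Lemma ratio_eq1 x y k : (char_ratio x y k == 1) = (x k == y k).
Proof.
apply/eqP/eqP => [|xy]; last first.
  by rewrite /char_ratio !rademacherE xy -!cisX conj_cis -cisD subrr cis0.
rewrite /char_ratio !rademacherE -!cisX conj_cis -cisD -mulrBl => /cis_eq1.
have xm := coord_lt k x; have ym := coord_lt k y.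
have pi0 : 0 < pi :> R by exact: pi_gt0.
have mk : 0 < (m k)%:R :> R by rewrite ltr0n; have := m_ge2 k; lia.
move=> H; apply: val_inj => /=; apply/eqP; rewrite -(eqr_nat R) -subr_eq0.
have : ((x k : nat)%:R - (y k : nat)%:R) * (2 * pi / (m k)%:R) = 0 :> R.
  apply: H; rewrite normrM [X in _ * X]ger0_norm ?divr_ge0 ?mulr_ge0 ?(ltW pi0)//.
  rewrite mulrA ltr_pdivrMr// mulrC ltr_pM2l ?mulr_gt0//.
  have : (x k : nat)%:R < (m k)%:R :> R by rewrite ltr_nat.
  have : (y k : nat)%:R < (m k)%:R :> R by rewrite ltr_nat.
  have : 0 <= (x k : nat)%:R :> R by [].
  have : 0 <= (y k : nat)%:R :> R by [].
  by move=> *; rewrite ltr_norml; apply/andP; split; lra.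
move=> /eqP; rewrite mulf_eq0 => /orP[//|].
by rewrite mulf_eq0 invr_eq0 (negbTE (m0 k)) orbF mulf_eq0 pnatr_eq0/= gt_eqF.
Qed.

Lemma psi_ratio n (x y : G) :
  vilenkin_psi R n x * (vilenkin_psi R n y)^* = chi m (char_ratio x y) n.
Proof.
rewrite /vilenkin_psi rmorph_prod -big_split/=; apply: eq_bigr => k _.
by rewrite rmorphXn -exprMn.
Qed.

Lemma level_psi n : of_level n (vilenkin_psi R n : G -> _).
Proof.
move=> x y xy; apply: eq_bigr => k _; rewrite /rademacher xy//.
Qed.

(** By duality: with z_k the root of unity of order m_k raised to the k-th digit
    of n, the value of psi_n at digit_point c is the c-th character of z.  The
    sum is thus the Dirichlet kernel D_(M_n) of z, and it vanishes because some
    digit of n is not 0. *)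
Lemma sum_psi n : (0 < n)%N -> \sum_(c < vM m n) vilenkin_psi R n (digit_point m c) = 0.
Proof.
move=> n0.
pose z k := cis (2 * pi / (m k)%:R : R) ^+ vdigit m n k.
have zr k : z k ^+ m k = 1 by rewrite /z -exprM mulnC exprM cis_root expr1n.
have -> : \sum_(c < vM m n) vilenkin_psi R n (digit_point m c) = dirichlet m z (vM m n).
  apply: eq_bigr => c _; rewrite (chi_widen m_ge2 z (ltn_ord c)).
  apply: eq_bigr => k _; rewrite rademacherE /z -!exprM; congr (_ ^+ _).
  rewrite mulnC; congr (_ * _)%N; rewrite /digit_point val_Zp_nat// modn_small// vdigit_lt//.
  exact: ltnW.
rewrite (dirichlet_vM m_ge2 zr) (_ : agree z n = false) ?mulr0//.
apply/negP => /forallP H.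
have : n = 0%N.
  rewrite (vdigit_sum n m_ge2) big1// => j _.
  have /eqP := H j; rewrite /z -cisX => /cis_eq1.
  have dm : (vdigit m n j < m j)%N by rewrite vdigit_lt// ltnW.
  have pi0 : 0 < pi :> R by exact: pi_gt0.
  have mk : 0 < (m j)%:R :> R by rewrite ltr0n; have := m_ge2 j; lia.
  have -> : `|(vdigit m n j)%:R * (2 * pi / (m j)%:R)| < 2 * pi :> R.
    rewrite ger0_norm ?mulr_ge0 ?divr_ge0 ?(ltW pi0)//.
    by rewrite mulrA ltr_pdivrMr// mulrC ltr_pM2l ?mulr_gt0// ltr_nat.
  move=> /(_ isT)/eqP; rewrite !mulf_eq0 invr_eq0 (negbTE (m0 j)) orbF.
  by rewrite !pnatr_eq0 (gt_eqF pi0) orbF orbF => /eqP ->.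
by move=> n00; rewrite n00 in n0.
Qed.

End characters.

(** * Integration of complex-valued functions *)

Section normc_bounds.
Local Open Scope complex_scope.
Variable R : realType.

Lemma ReM (z w : R[i]) :
  complex.Re (z * w) = complex.Re z * complex.Re w - complex.Im z * complex.Im w.
Proof. by case: z; case: w. Qed.

Lemma ImM (z w : R[i]) :
  complex.Im (z * w) = complex.Re z * complex.Im w + complex.Im z * complex.Re w.
Proof. by case: z; case: w. Qed.

Lemma ReD (z w : R[i]) : complex.Re (z + w) = complex.Re z + complex.Re w.
Proof. by case: z; case: w. Qed.

Lemma ImD (z w : R[i]) : complex.Im (z + w) = complex.Im z + complex.Im w.
Proof. by case: z; case: w. Qed.

Lemma normcC (z : R[i]) : (Normc.normc z)%:C = `|z|.
Proof. by rewrite normc_def; case: z. Qed.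

Lemma normc_ge0 (z : R[i]) : 0 <= Normc.normc z.
Proof. by case: z => a b; exact: sqrtr_ge0. Qed.

Lemma normc_le_ReIm (z : R[i]) :
  Normc.normc z <= `|complex.Re z| + `|complex.Im z|.
Proof.
case: z => a b /=; rewrite -[leRHS]ger0_norm ?addr_ge0// -sqrtr_sqr.
rewrite ler_wsqrtr// sqrrD !real_normK ?num_real// addrAC lerDl.
by rewrite mulrn_wge0// mulr_ge0.
Qed.

Lemma normRe_le (z : R[i]) : `|complex.Re z| <= Normc.normc z.
Proof. by case: z => a b /=; rewrite -sqrtr_sqr ler_wsqrtr// lerDl sqr_ge0. Qed.

Lemma normIm_le (z : R[i]) : `|complex.Im z| <= Normc.normc z.
Proof. by case: z => a b /=; rewrite -sqrtr_sqr ler_wsqrtr// lerDr sqr_ge0. Qed.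

End normc_bounds.

Section complex_integration.
Local Open Scope complex_scope.
Variables (R : realType) (m : nat -> nat).
Hypothesis m_ge2 : forall k, (2 <= m k)%N.
Variable mu : {measure set (vilenkin m) -> \bar R}.
Hypothesis mu_product : is_product_measure mu.
Local Notation G := (vilenkin m).

Definition cintegrable (g : G -> R[i]) :=
  mu.-integrable setT (EFin \o (fun x => complex.Re (g x))) /\
  mu.-integrable setT (EFin \o (fun x => complex.Im (g x))).

Lemma cintegrableD g h : cintegrable g -> cintegrable h ->
  cintegrable (fun x => g x + h x).
Proof.
move=> [g1 g2] [h1 h2]; split.
  apply: eq_integrable (integrableD measurableT g1 h1) => // x _ /=.
  by rewrite ReD.
apply: eq_integrable (integrableD measurableT g2 h2) => // x _ /=.
by rewrite ImD.
Qed.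

Lemma complex_integralD g h : cintegrable g -> cintegrable h ->
  complex_integral mu (fun x => g x + h x) =
  complex_integral mu g + complex_integral mu h.
Proof.
move=> [g1 g2] [h1 h2]; rewrite /complex_integral.
under eq_Rintegral do rewrite ReD.
under [X in _ +i* X]eq_Rintegral do rewrite ImD.
by rewrite !RintegralD.
Qed.

Lemma cintegrableZ (c : R[i]) g : cintegrable g -> cintegrable (fun x => c * g x).
Proof.
move=> [g1 g2]; split.
  apply: eq_integrable (integrableB measurableT (integrableZl measurableT (complex.Re c) g1)
    (integrableZl measurableT (complex.Im c) g2)) => // x _ /=.
  by rewrite ReM.
apply: eq_integrable (integrableD measurableT (integrableZl measurableT (complex.Re c) g2)
    (integrableZl measurableT (complex.Im c) g1)) => // x _ /=.
by rewrite ImM.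
Qed.

Lemma complex_integralZ (c : R[i]) g : cintegrable g ->
  complex_integral mu (fun x => c * g x) = c * complex_integral mu g.
Proof.
move=> [g1 g2]; rewrite /complex_integral.
under eq_Rintegral do rewrite ReM.
under [X in _ +i* X]eq_Rintegral do rewrite ImM.
have h1 a : mu.-integrable setT (EFin \o (fun x => a * complex.Re (g x))).
  exact: (integrableZl measurableT a g1).
have h2 a : mu.-integrable setT (EFin \o (fun x => a * complex.Im (g x))).
  exact: (integrableZl measurableT a g2).
rewrite RintegralB// RintegralD// !RintegralZl//.
by case: c {h1 h2} => a b.
Qed.

Lemma cintegrable0 : cintegrable (fun=> 0).
Proof. by split; exact: integrable0. Qed.

Lemma complex_integral0 : complex_integral mu (fun=> 0) = 0.
Proof. by rewrite /complex_integral /Rintegral integral0. Qed.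

Lemma cintegrable_sum n (g : nat -> G -> R[i]) :
  (forall k, cintegrable (g k)) -> cintegrable (fun x => \sum_(k < n) g k x).
Proof.
move=> H; elim: n => [|n IH].
  by under eq_fun do rewrite big_ord0; exact: cintegrable0.
by under eq_fun do rewrite big_ord_recr/=; exact: cintegrableD.
Qed.

Lemma complex_integral_sum n (g : nat -> G -> R[i]) :
  (forall k, cintegrable (g k)) ->
  complex_integral mu (fun x => \sum_(k < n) g k x) =
  \sum_(k < n) complex_integral mu (g k).
Proof.
move=> H; elim: n => [|n IH].
  by under eq_fun do rewrite big_ord0; rewrite complex_integral0 big_ord0.
under eq_fun do rewrite big_ord_recr/=.
by rewrite complex_integralD// ?IH ?big_ord_recr//; exact: cintegrable_sum.
Qed.

Lemma integrable_level (u h : G -> R) n : mu.-integrable setT (EFin \o u) ->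
  of_level n h -> mu.-integrable setT (EFin \o (fun x => u x * h x)).
Proof.
move=> iu nh; have [K K0 HK] := level_bounded m_ge2 nh.
apply: eq_integrable (@integrableMl _ _ _ mu setT measurableT _ h iu _ _) => //.
  exact: level_measurable_fun nh.
by exists K; split => [|M HM y _]; [exact: ger0_real|exact: le_trans (HK y) (ltW HM)].
Qed.

Lemma cintegrable_level n (g h : G -> R[i]) : cintegrable g -> of_level n h ->
  cintegrable (fun x => g x * h x).
Proof.
move=> [g1 g2] nh.
have n1 : of_level n (fun x => complex.Re (h x)) by move=> x y xy; rewrite (nh x y xy).
have n2 : of_level n (fun x => complex.Im (h x)) by move=> x y xy; rewrite (nh x y xy).
split.
  apply: eq_integrable (integrableB measurableT (integrable_level g1 n1)
    (integrable_level g2 n2)) => // x _ /=.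
  by rewrite ReM.
apply: eq_integrable (integrableD measurableT (integrable_level g1 n2)
    (integrable_level g2 n1)) => // x _ /=.
by rewrite ImM.
Qed.

Lemma integrable_cst (c : R) : mu.-integrable setT (EFin \o (fun=> c)).
Proof.
apply: (@measurable_bounded_integrable _ _ _ _ (fun=> c)) => //.
  by rewrite (mu_setT mu_product) ltry.
by exists (`|c|); split => // M HM y _ /=; exact: ltW.
Qed.

Lemma cintegrable_cst (c : R[i]) : cintegrable (fun=> c).
Proof. by split; exact: integrable_cst. Qed.

(** Adding a constant reduces the claim to the decomposition of the integral of
    a nonnegative function. *)
Lemma Rintegral_level n (h : G -> R) : of_level n h ->
  (\int[mu]_x h x)%R = (vM m n)%:R^-1 * \sum_(c < vM m n) h (digit_point m c).
Proof.
move=> nh; have [K K0 HK] := level_bounded m_ge2 nh.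
have mh := level_measurable_fun m_ge2 nh.
have ih : mu.-integrable setT (EFin \o h).
  apply: eq_integrable (integrable_level (integrable_cst 1) nh) => // x _ /=.
  by rewrite mul1r.
have M0 : (vM m n)%:R != 0 :> R by rewrite pnatr_eq0 -lt0n vM_gt0.
have E : (\int[mu]_x (h x + K) =
    (vM m n)%:R^-1 * \sum_(c < vM m n) (h (digit_point m c) + K))%R.
  rewrite /Rintegral (@ge0_integral_level m m_ge2 R mu n setT)//; last 2 first.
  - by apply/measurable_EFinP; exact: measurable_funD.
  - by move=> x; rewrite lee_fin; have := HK x; rewrite ler_norml => /andP[]; lra.
  rewrite (eq_bigr (fun c : 'I__ => ((vM m n)%:R^-1 * (h (digit_point m c) + K))%:E)).
    rewrite (eq_bigl predT); last by move=> c; apply/asboolP.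
    by rewrite sumEFin/= mulr_sumr.
  move=> c _; rewrite mulrC EFinM -(mu_cell mu_product n (digit_point m c)).
  rewrite -integral_cst; last exact: measurable_cell.
  by apply: eq_integral => y; rewrite inE => yc; rewrite (nh y (digit_point m c)).
have := E; rewrite RintegralD//; last exact: integrable_cst.
rewrite Rintegral_cst// (mu_setT mu_product) mulr1 big_split/= sumr_const card_ord.
move=> /(canRL (addrK _)) ->; rewrite mulrDr -[K *+ _]mulr_natr [K * _]mulrC.
by rewrite mulKf// addrK.
Qed.

Lemma complex_integral_level n (h : G -> R[i]) : of_level n h ->
  complex_integral mu h = (vM m n)%:R^-1 * \sum_(c < vM m n) h (digit_point m c).
Proof.
move=> nh.
have n1 : of_level n (fun x => complex.Re (h x)) by move=> x y xy; rewrite (nh x y xy).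
have n2 : of_level n (fun x => complex.Im (h x)) by move=> x y xy; rewrite (nh x y xy).
rewrite /complex_integral (Rintegral_level n1) (Rintegral_level n2).
have E : \sum_(c < vM m n) h (digit_point m c) =
    (\sum_(c < vM m n) complex.Re (h (digit_point m c))) +i*
    (\sum_(c < vM m n) complex.Im (h (digit_point m c))).
  elim/big_ind3: _ => //; first by move=> ? ? ? ? ? ? -> ->.
  by move=> c _; case: (h _).
rewrite E; have -> : (vM m n)%:R^-1 = ((vM m n)%:R^-1 : R)%:C :> R[i].
  by rewrite fmorphV rmorph_nat.
by simpc.
Qed.

End complex_integration.

(** * Sums of partial sums as integrals against the Fejer kernel *)

Section fejer.
Local Open Scope complex_scope.
Variables (R : realType) (m : nat -> nat).
Hypothesis m_ge2 : forall k, (2 <= m k)%N.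
Variable mu : {measure set (vilenkin m) -> \bar R}.
Hypothesis mu_product : is_product_measure mu.
Variable B : nat.
Hypothesis m_le : forall k, (m k <= B)%N.
Local Notation G := (vilenkin m).

Lemma psi0 (x : G) : vilenkin_psi R 0 x = 1.
Proof. by rewrite /vilenkin_psi big_ord0. Qed.

Lemma level_conj_psi j : of_level j (fun y : G => (vilenkin_psi R j y)^*%R).
Proof. by move=> x y xy; rewrite (@level_psi R m j x y xy). Qed.

Lemma integral_conj_psi j : (0 < j)%N ->
  complex_integral mu (fun y => (vilenkin_psi R j y)^*%R) = 0.
Proof.
move=> j0; rewrite (complex_integral_level m_ge2 mu_product (@level_conj_psi j)).
by rewrite -rmorph_sum sum_psi// rmorph0 mulr0.
Qed.

Lemma fourier_coef_cst (c : R[i]) j :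
  fourier_coef mu (fun=> c) j = if j == 0%N then c else 0.
Proof.
have icst := cintegrable_cst mu_product 1.
rewrite /fourier_coef complex_integralZ; last first.
  have := cintegrable_level m_ge2 icst (@level_conj_psi j).
  by congr cintegrable; apply/funext => y; rewrite mul1r.
case: eqP => [->|/eqP j0]; last by rewrite integral_conj_psi ?mulr0// lt0n.
under eq_fun do rewrite psi0 rmorph1.
have n0 : of_level 0 (fun _ : G => 1 : R[i]) by [].
rewrite (complex_integral_level m_ge2 mu_product n0) vM0.
by rewrite big_ord_recl big_ord0 addr0 invr1 !mulr1.
Qed.

(** The partial sum S_0 is 0, whence the factor n.-1. *)
Lemma sum_partial_sum_cst (c : R[i]) n x :
  \sum_(k < n) partial_sum mu (fun=> c) k x = n.-1%:R * c.
Proof.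
case: n => [|n]; first by rewrite big_ord0 mul0r.
rewrite big_ord_recl/= {1}/partial_sum big_ord0 add0r.
under eq_bigr => k _.
  rewrite /partial_sum/= /bump/= big_ord_recl/= fourier_coef_cst/= psi0 mulr1.
  rewrite big1 ?addr0; last by move=> j _; rewrite fourier_coef_cst/= mul0r.
  over.
by rewrite sumr_const card_ord mulr_natl.
Qed.

Lemma sum_partial_sumE (h : G -> R[i]) n x : cintegrable mu h ->
  \sum_(k < n) partial_sum mu h k x =
  complex_integral mu (fun y => h y * fejer_sum m (char_ratio R x y) n).
Proof.
move=> ih.
have ihp j : cintegrable mu (fun y => h y * (vilenkin_psi R j y)^*%R).
  exact: cintegrable_level (@level_conj_psi j).
have ihp' j : cintegrable mu (fun y => vilenkin_psi R j x * (h y * (vilenkin_psi R j y)^*%R)).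
  exact: cintegrableZ.
under [in RHS]eq_fun => y.
  rewrite /fejer_sum mulr_sumr.
  under eq_bigr => k _.
    rewrite /dirichlet mulr_sumr.
    under eq_bigr => j _ do rewrite -psi_ratio mulrCA.
    over.
  over.
rewrite (@complex_integral_sum R m mu n (fun k y =>
  \sum_(j < k) vilenkin_psi R j x * (h y * (vilenkin_psi R j y)^*%R))); last first.
  by move=> k; apply: (@cintegrable_sum R m mu k (fun j y =>
     vilenkin_psi R j x * (h y * (vilenkin_psi R j y)^*%R))).
apply: eq_bigr => k _.
rewrite (@complex_integral_sum R m mu k (fun j y =>
     vilenkin_psi R j x * (h y * (vilenkin_psi R j y)^*%R)))//.
apply: eq_bigr => j _; rewrite complex_integralZ//.
by rewrite mulrC.
Qed.

Lemma level_fejer_sum n x : of_level n (fun y : G => fejer_sum m (char_ratio R x y) n).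
Proof.
move=> y y' yy'; apply: eq_bigr => k _; apply: eq_bigr => j _.
rewrite -!psi_ratio; congr (_ * Num.conj _); apply: level_psi => i ij.
by apply: yy'; rewrite (ltn_trans ij)// (ltn_trans (ltn_ord j)).
Qed.

(** The kernel F_n has integral n.-1, which allows f(x) to be subtracted under the
    integral sign. *)
Lemma sum_partial_sumB (f : G -> R[i]) n x : cintegrable mu f ->
  \sum_(k < n) partial_sum mu f k x - n.-1%:R * f x =
  complex_integral mu (fun y => (f y - f x) * fejer_sum m (char_ratio R x y) n).
Proof.
move=> fi; have ci := cintegrable_cst mu_product (- f x).
rewrite -mulrN -(sum_partial_sum_cst _ _ x) !sum_partial_sumE//.
rewrite -complex_integralD; last 2 first.
- exact: cintegrable_level (@level_fejer_sum n x).
- exact: cintegrable_level (@level_fejer_sum n x).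
by congr complex_integral; apply/funext => y; rewrite mulrDl.
Qed.

Lemma fejer_majorant_le_majorant l (x y : G) :
  fejer_majorant m (char_ratio R x y) l <= (majorant R l x y)%:C.
Proof.
have agreeP n : agree (char_ratio R x y) n -> y \in cell n x.
  move=> /forallP H; rewrite inE => k kn.
  by have := H (Ordinal kn); rewrite ratio_eq1// => /eqP ->.
rewrite /fejer_majorant /majorant rmorphD rmorph_sum/= lerD//.
  rewrite rmorphM/= rmorph_nat ler_wpM2l// indicE rmorph_nat ler_nat.
  by case: (boolP (agree _ _)) => // /agreeP ->.
apply: ler_sum => t _; rewrite rmorphM/= rmorph_nat ler_wpM2l//.
have p0 (r : 'Z_(m t)) : 0 <= \1_(cell l (replace_coord r x)) y :> R by rewrite indicE.
case: (boolP (agree_off _ _ _)) => [/forallP H|_]; last first.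
  by rewrite ler0c sumr_ge0.
rewrite (_ : true%:R = 1%:C)// lecR (bigD1 (y t))//=.
rewrite [X in X + _]indicE mem_set ?lerDl ?sumr_ge0// => k kl.
have [->|/eqP kt] := eqVneq k t; first by rewrite /replace_coord eqtype.dfwith_in.
rewrite replace_coord_out//; have := H (Ordinal kl); rewrite /= ratio_eq1//.
by move/eqP: kt => -> /eqP ->.
Qed.

Lemma normc_fejer_sum_le N n (x y : G) : (n < vM m N)%N ->
  Normc.normc (fejer_sum m (char_ratio R x y) n) <=
  3 * B%:R ^+ 2 * \sum_(l < N) (vM m l)%:R * majorant R l x y.
Proof.
move=> nN; rewrite -lecR normcC.
apply: (le_trans (norm_fejer_le m_ge2 (ratio_root R m_ge2 x y) m_le nN)).
rewrite rmorphM/= rmorph_sum/= rmorphM/= rmorphXn/= !rmorph_nat.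
apply: ler_wpM2l; first by rewrite mulr_ge0// exprn_ge0.
apply: ler_sum => l _; rewrite rmorphM/= rmorph_nat ler_wpM2l//.
exact: fejer_majorant_le_majorant.
Qed.

(** The factor 6 is twice that of the kernel bound, as the real and the imaginary
    part of the integral are estimated separately. *)
Lemma fejer_bound (f : G -> R[i]) N n x : cintegrable mu f -> (n < vM m N)%N ->
  Normc.normc (\sum_(k < n) partial_sum mu f k x - n.-1%:R * f x) <=
  6 * B%:R ^+ 2 * \sum_(l < N) (vM m l)%:R *
    (fine (osc mu (fun y => complex.Re (f y)) l x) +
     fine (osc mu (fun y => complex.Im (f y)) l x)).
Proof.
move=> fi nN; rewrite sum_partial_sumB//.
set u := fun y => complex.Re (f y); set v := fun y => complex.Im (f y).
set g := fun y => (f y - f x) * _.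
have [iu iv] := fi.
have [mu' mv'] : measurable_fun setT u /\ measurable_fun setT v.
  by split; apply/measurable_EFinP; [exact: measurable_int iu|exact: measurable_int iv].
have [g1 g2] : cintegrable mu g.
  apply: cintegrable_level (@level_fejer_sum n x) => //.
  exact: cintegrableD fi (cintegrable_cst mu_product (- f x)).
pose S y := \sum_(l < N) (vM m l)%:R * majorant R l x y.
have S0 y : 0 <= S y.
  by apply: sumr_ge0 => l _; rewrite mulr_ge0// majorant_ge0.
pose w l y := `|u y - u x| * majorant R l x y + `|v y - v x| * majorant R l x y.
have C0 : 0 <= 3 * B%:R ^+ 2 :> R by rewrite mulr_ge0// exprn_ge0.
have gle y : Normc.normc (g y) <=
    3 * B%:R ^+ 2 * \sum_(l < N) (vM m l)%:R * w l y.
  rewrite Normc.normcM.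
  apply: (@le_trans _ _ ((`|u y - u x| + `|v y - v x|) * (3 * B%:R ^+ 2 * S y))).
    apply: ler_pM => //; try exact: normc_ge0.
      apply: le_trans (normc_le_ReIm _) _; rewrite /u /v.
      by case: (f y) => a b; case: (f x) => a' b' /=.
    exact: normc_fejer_sum_le.
  rewrite mulrCA ler_wpM2l// mulr_sumr le_eqVlt; apply/orP; left; apply/eqP.
  by apply: eq_bigr => l _; rewrite mulrCA /w -mulrDl.
have mw l : measurable_fun setT (fun y => (w l y)%:E).
  apply/measurable_EFinP; apply: measurable_funD; apply: measurable_funM.
  - by apply: measurableT_comp => //; exact: measurable_funB.
  - exact: measurable_majorant.
  - by apply: measurableT_comp => //; exact: measurable_funB.
  - exact: measurable_majorant.
have w0 l y : 0 <= w l y by rewrite addr_ge0// mulr_ge0// majorant_ge0.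
have iw l : (\int[mu]_y (w l y)%:E =
    (fine (osc mu u l x) + fine (osc mu v l x))%:E)%E.
  have md (h : G -> R) : measurable_fun setT h ->
      measurable_fun setT (fun y => (`|h y - h x| * majorant R l x y)%:E).
    move=> mh; apply/measurable_EFinP; apply: measurable_funM.
      by apply: measurableT_comp => //; exact: measurable_funB.
    exact: measurable_majorant.
  rewrite EFinD !fineK ?ge0_fin_numE ?osc_ge0 ?osc_lty//.
  under eq_integral do rewrite EFinD.
  rewrite ge0_integralD//; try exact: md.
  - by move=> y _; rewrite lee_fin mulr_ge0// majorant_ge0.
  - by move=> y _; rewrite lee_fin mulr_ge0// majorant_ge0.
set T := \sum_(l < N) _.
have bound (h : G -> R) : mu.-integrable setT (EFin \o h) ->
    (forall y, `|h y| <= Normc.normc (g y)) ->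
    `|(\int[mu]_y h y)%R| <= 3 * B%:R ^+ 2 * T.
  move=> ih hg; rewrite -lee_fin EFin_normr_Rintegral//.
  have mh := measurable_int mu ih.
  apply: (le_trans (le_abse_integral mu measurableT mh)).
  apply: (@le_trans _ _ (\int[mu]_y ((3 * B%:R ^+ 2)%:E *
     \sum_(l < N) (vM m l)%:R%:E * (w l y)%:E))%E).
    apply: ge0_le_integral => //.
    - by apply: measurableT_comp.
    - by apply: measurable_funeM; apply: emeasurable_sum => l; exact: measurable_funeM.
    - move=> y _; rewrite (_ : (\sum_(l < N) _)%E = (\sum_(l < N) (vM m l)%:R * w l y)%:E).
        by rewrite -EFinM lee_fin; apply: le_trans (hg y) (gle y).
      by rewrite -sumEFin; apply: eq_bigr => l _; rewrite EFinM.
  rewrite ge0_integralZl//; first last.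
  - by move=> y _; apply: sume_ge0 => l _; rewrite mule_ge0 ?lee_fin.
  - by apply: emeasurable_sum => l; exact: measurable_funeM.
  rewrite [leRHS]EFinM lee_wpmul2l ?lee_fin// ge0_integral_sum//; first last.
  - by move=> l y _; rewrite mule_ge0 ?lee_fin.
  - by move=> l; exact: measurable_funeM.
  rewrite /T -sumEFin le_eqVlt; apply/orP; left; apply/eqP.
  apply: eq_bigr => l _; rewrite ge0_integralZl ?iw ?EFinM//.
  by move=> y _; rewrite lee_fin.
apply: (le_trans (normc_le_ReIm _)).
have -> : 6 * B%:R ^+ 2 * T = 3 * B%:R ^+ 2 * T + 3 * B%:R ^+ 2 * T by ring.
rewrite lerD//=; apply: bound => // y; [exact: normRe_le|exact: normIm_le].
Qed.

End fejer.

(** * Summation by parts and the conclusion *)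

Section abel.
Variable C : numFieldType.
Variables (a q : nat -> C).

Lemma abel_summation n : \sum_(k < n.+1) q k * a k =
  q n * (\sum_(k < n.+1) a k) -
  \sum_(j < n) (q j.+1 - q j) * (\sum_(k < j.+1) a k).
Proof.
elim: n => [|n IH]; first by rewrite !big_ord_recl !big_ord0 subr0 !addr0.
rewrite big_ord_recr IH [in RHS]big_ord_recr [X in _ = _ - X]big_ord_recr /=.
ring.
Qed.

Hypothesis q_ge0 : forall k, 0 <= q k.
Hypothesis q_le : forall k, q k <= q k.+1.

(** As q is non-decreasing, the coefficients q_(j + 1) - q_j are nonnegative and
    telescope, so together with q_(n - 1) they weigh at most 2 q_(n - 1). *)
Lemma norm_abel_sum (K e : C) n : 0 <= K -> 0 <= e ->
  (forall n, `|\sum_(k < n) a k| <= K + e * n%:R) ->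
  `|\sum_(k < n) q k * a k| <= 2 * q n.-1 * (K + e * n%:R).
Proof.
move=> K0 e0 H; case: n => [|n].
  by rewrite big_ord0 normr0 !mulr_ge0// addr_ge0// mulr_ge0.
have X0 : 0 <= K + e * n.+1%:R by rewrite addr_ge0// mulr_ge0.
rewrite abel_summation (le_trans (ler_normB _ _))//.
have -> : 2 * q n.+1.-1 * (K + e * n.+1%:R) =
  q n * (K + e * n.+1%:R) + q n * (K + e * n.+1%:R) by rewrite /=; ring.
rewrite lerD//; first by rewrite normrM ger0_norm// ler_wpM2l.
apply: (@le_trans _ _ (\sum_(j < n) (q j.+1 - q j) * (K + e * n.+1%:R))).
  rewrite (le_trans (ler_norm_sum _ _ _))// ler_sum// => j _.
  rewrite normrM ger0_norm ?subr_ge0// ler_wpM2l ?subr_ge0//.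
  rewrite (le_trans (H _))// lerD2l ler_wpM2l// ler_nat ltnS ltnW//.
rewrite -mulr_suml ler_wpM2r//.
have -> : \sum_(j < n) (q j.+1 - q j) = q n - q 0%N.
  by rewrite -(big_mkord xpredT (fun j => q j.+1 - q j)) telescope_sumr.
by rewrite lerBlDr lerDl.
Qed.

End abel.

Section weighted.
Variables (R : realType) (m : nat -> nat).
Hypothesis m_ge2 : forall k, (2 <= m k)%N.

Lemma sum_vM_le N : (\sum_(l < N.+1) vM m l <= 2 * vM m N)%N.
Proof.
elim: N => [|N IH]; first by rewrite big_ord_recl big_ord0 /= vM0.
rewrite big_ord_recr /= (leq_trans (leq_add IH (leqnn _)))//.
have : (2 * vM m N <= m N * vM m N)%N by rewrite leq_mul2r m_ge2 orbT.
by rewrite -vMS; clear; lia.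
Qed.

(** A limit of weighted means: the M_l grow geometrically, so the weights of the
    last levels dominate. *)
Lemma weighted_sum_le (W : nat -> R) (e : R) : (forall l, 0 <= W l) ->
  W @ \oo --> (0 : R) -> 0 < e ->
  exists2 K, 0 <= K & forall N,
    \sum_(l < N.+1) (vM m l)%:R * W l <= K + e * (vM m N)%:R.
Proof.
move=> W0 cW e0; have e2 : 0 < e / 2 by rewrite divr_gt0.
move/cvgrPdist_le : cW => /(_ _ e2)[L _ HL].
have p0 l : 0 <= (vM m l)%:R * W l by rewrite mulr_ge0.
exists (\sum_(l < L) (vM m l)%:R * W l); first exact: sumr_ge0.
have H n : \sum_(l < n) (vM m l)%:R * W l <=
    \sum_(l < L) (vM m l)%:R * W l + e / 2 * \sum_(l < n) (vM m l)%:R.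
  have s0 : 0 <= e / 2 * \sum_(l < n) (vM m l)%:R.
    by rewrite mulr_ge0 ?sumr_ge0// divr_ge0// ltW.
  have [nL|/ltnW Ln] := leqP n L.
    (* for n <= L all terms are among the first L ones, kept in K *)
    rewrite -(subnKC nL) big_split_ord /= -addrA lerDl addr_ge0// sumr_ge0//.
  rewrite -(subnKC Ln) big_split_ord /= lerD2l big_split_ord /= mulrDr.
  rewrite (@le_trans _ _ (e / 2 * \sum_(i < n - L) (vM m (L + i))%:R))//.
    rewrite mulr_sumr ler_sum// => i _; rewrite mulrC ler_wpM2r//.
    have := HL (L + i)%N (leq_addr _ _); rewrite sub0r normrN.
    exact: le_trans (ler_norm _).
  by rewrite lerDr mulr_ge0 ?sumr_ge0// divr_ge0// ltW.
move=> N; rewrite (le_trans (H _))// lerD2l -natr_sum.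
rewrite (@le_trans _ _ (e / 2 * (2 * vM m N)%:R))//.
  by rewrite ler_wpM2l ?divr_ge0 ?(ltW e0)// ler_nat sum_vM_le.
by rewrite natrM mulrA divfK.
Qed.

Lemma vM_bracket n : n = 0%N \/ exists2 N, (vM m N <= n)%N & (n < vM m N.+1)%N.
Proof.
have := @ex_minnP (fun N => n < vM m N)%N (ex_intro _ n (vM_gt n m_ge2)).
case=> -[|N] nN Nmin; first by left; move: nN; rewrite vM0 ltnS leqn0 => /eqP.
by right; exists N => //; rewrite leqNgt; apply/negP => /Nmin; rewrite ltnn.
Qed.

End weighted.

Section convergence.
Variables (R : realType) (m : nat -> nat).
Hypothesis m_ge2 : forall k, (2 <= m k)%N.
Variable mu : {measure set (vilenkin m) -> \bar R}.
Hypothesis mu_product : is_product_measure mu.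
Variable B : nat.
Hypothesis m_le : forall k, (m k <= B)%N.
Local Notation G := (vilenkin m).

Lemma cintegrable_L1 (f : G -> R[i]) : complex_L1 mu f -> cintegrable mu f.
Proof.
move=> [mr mi fi].
have mn : measurable_fun setT (fun x => Normc.normc (f x)).
  have -> : (fun x => Normc.normc (f x)) = (@Num.sqrt R \o
      (fun x => complex.Re (f x) ^+ 2 + complex.Im (f x) ^+ 2)).
    by apply/funext => x /=; case: (f x).
  apply: measurableT_comp.
    by apply: continuous_measurable_fun; exact: sqrt_continuous.
  by apply: measurable_funD; exact: measurable_funX.
split; apply/integrableP; split; try exact/measurable_EFinP.
  apply: le_lt_trans fi; apply: ge0_le_integral => //.
  - by apply: measurableT_comp => //; exact/measurable_EFinP.
  - exact/measurable_EFinP.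
  - by move=> x _; rewrite lee_fin; exact: normRe_le.
apply: le_lt_trans fi; apply: ge0_le_integral => //.
- by apply: measurableT_comp => //; exact/measurable_EFinP.
- exact/measurable_EFinP.
- by move=> x _; rewrite lee_fin; exact: normIm_le.
Qed.

(** Both oscillations tend to 0 at almost every x, so this is the almost everywhere
    summability by arithmetic means, in the form A_n(x) = o(n) that summation by
    parts requires. *)
Lemma partial_sum_dev_le (f : G -> R[i]) x (e : R) : cintegrable mu f ->
  (fun l => fine (osc mu (fun y => complex.Re (f y)) l x)) @ \oo --> (0 : R) ->
  (fun l => fine (osc mu (fun y => complex.Im (f y)) l x)) @ \oo --> (0 : R) ->
  0 < e ->
  exists2 K, 0 <= K & forall n,
    Normc.normc (\sum_(k < n) (partial_sum mu f k x - f x)) <= K + e * n%:R.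
Proof.
move=> fi cu cv e0.
pose W l := fine (osc mu (fun y => complex.Re (f y)) l x) +
  fine (osc mu (fun y => complex.Im (f y)) l x).
have W0 l : 0 <= W l by rewrite addr_ge0// fine_ge0// osc_ge0.
have cW : W @ \oo --> (0 : R) by rewrite -(addr0 0); exact: cvgD.
have c0 : 0 < 6 * B%:R ^+ 2 + 1 :> R.
  by rewrite ltr_wpDl// mulr_ge0// exprn_ge0.
have [|K K0 HK] := @weighted_sum_le R m m_ge2 W (e / (6 * B%:R ^+ 2 + 1)) W0 cW.
  by rewrite divr_gt0.
exists (6 * B%:R ^+ 2 * K + Normc.normc (f x)).
  by rewrite addr_ge0 ?normc_ge0// !mulr_ge0// exprn_ge0.
move=> n; rewrite sumrB sumr_const card_ord.
have [->|[N Nn nN]] := vM_bracket m_ge2 n.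
  rewrite big_ord0 mulr0n subrr Normc.normc0 mulr0 addr0.
  by rewrite addr_ge0 ?normc_ge0// !mulr_ge0// exprn_ge0.
have n0 : (0 < n)%N by rewrite (leq_trans _ Nn)// vM_gt0.
have -> : \sum_(k < n) partial_sum mu f k x - f x *+ n =
    (\sum_(k < n) partial_sum mu f k x - n.-1%:R * f x) - f x.
  have -> : f x *+ n = n.-1%:R * f x + f x by rewrite mulr_natl -mulrSr prednK.
  by rewrite opprD addrA.
rewrite (le_trans (le_normcD _ _))// normcN.
rewrite -addrA [_ + e * _]addrC addrA lerD2r.
have := fejer_bound m_ge2 mu_product m_le x fi nN.
have c6 : 0 <= 6 * B%:R ^+ 2 :> R by rewrite mulr_ge0// exprn_ge0.
move=> /le_trans; apply; rewrite (le_trans (ler_wpM2l c6 (HK N)))//.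
rewrite mulrDr lerD2l mulrA.
apply: (@le_trans _ _ (e * (vM m N)%:R)); last first.
  by rewrite ler_wpM2l ?(ltW e0)// ler_nat.
rewrite ler_wpM2r// mulrCA -[leRHS]mulr1 ler_wpM2l ?(ltW e0)//.
by rewrite ler_pdivrMr// mul1r lerDl.
Qed.

Lemma T_mean_dev_le (f : G -> R[i]) (q : nat -> R) n x (K e : R) :
  (forall k, 0 <= q k) -> 0 < q 0%N -> (forall k, q k <= q k.+1) ->
  0 <= K -> 0 <= e ->
  (forall n, Normc.normc (\sum_(k < n) (partial_sum mu f k x - f x)) <= K + e * n%:R) ->
  (0 < n)%N ->
  `|f x - T_mean mu q f n x| <= (2 * (q n.-1 / Qsum q n) * (K + e * n%:R))%:C%C.
Proof.
move=> q0 q00 qS K0 e0 H n0.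
have Q0 : 0 < Qsum q n.
  rewrite /Qsum -(prednK n0) big_ord_recl ltr_pwDl// sumr_ge0//.
have -> : f x - T_mean mu q f n x =
   - (((Qsum q n)^-1)%:C%C * \sum_(k < n) (q k)%:C%C * (partial_sum mu f k x - f x)).
  under [in RHS]eq_bigr do rewrite mulrBr.
  rewrite sumrB -mulr_suml -rmorph_sum/= mulrBr opprB; congr (_ - _).
  by rewrite mulrA -rmorphM/= mulVf ?gt_eqF// mul1r.
rewrite normrN normrM [X in X * _]ger0_norm; last by rewrite ler0c invr_ge0 ltW.
rewrite [leRHS](_ : _ = ((Qsum q n)^-1)%:C%C * (2 * q n.-1 * (K + e * n%:R))%:C%C); last first.
  by rewrite -rmorphM; congr (_%:C)%C; ring.
rewrite ler_wpM2l ?ler0c ?invr_ge0 ?(ltW Q0)//.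
have := @norm_abel_sum _ (fun k => partial_sum mu f k x - f x) (fun k => (q k)%:C%C) _ _
  K%:C%C e%:C%C n.
have -> : ((2 * q n.-1 * (K + e * n%:R))%:C = 2 * (q n.-1)%:C * (K%:C + e%:C * n%:R))%C.
  by rewrite !rmorphM/= rmorph_nat rmorphD rmorphM/= rmorph_nat.
rewrite !ler0c; apply => //.
- by move=> k; rewrite ler0c.
- by move=> k; rewrite lecR.
- move=> N; rewrite -normcC; apply: (@le_trans _ _ (K + e * N%:R)%:C%C).
    by rewrite lecR.
  by rewrite rmorphD rmorphM/= rmorph_nat.
Qed.

End convergence.

Theorem corollary5 (R : realType) (m : nat -> nat)
    (m_ge2 : forall k, (2 <= m k)%N)
    (m_bounded : exists B : nat, forall k, (m k <= B)%N)
    (mu : {measure set (vilenkin m) -> \bar R})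
    (mu_product : is_product_measure mu)
    (f : vilenkin m -> R[i]) (f_L1 : complex_L1 mu f)
    (q : nat -> R)
    (q_ge0 : forall k, 0 <= q k)
    (q0_gt0 : 0 < q 0%N)
    (q_nondecreasing : {homo q : k l / (k <= l)%N >-> k <= l})
    (q_growth : (fun n => q n.-1 / Qsum q n : R^o) =O_\oo
                (fun n => n%:R^-1 : R^o)) :
  {ae mu, forall x, (fun n => T_mean mu q f n x : R[i]^o) @ \oo -->
                    (f x : R[i]^o)}.
Proof.
have [B m_le] := m_bounded.
have fi := cintegrable_L1 f_L1; have [iu iv] := fi.
have [A A0 [N0 _ HA]] := (eqO_exP _ _ _).1 q_growth.
apply: filterS2 (osc_cvg m_ge2 mu_product m_le iu)
  (osc_cvg m_ge2 mu_product m_le iv) => x cu cv.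
apply/cvgrPdist_le => eps eps0.
have [e ee] : exists e, eps = e%:C%C.
  by apply/complex_realP; rewrite gtr0_real.
move: eps0; rewrite ee (_ : 0 = 0%:C%C)// ltcR => e0.
(* A bounds n q_(n-1) / Q_n for large n, so slope e / (4 A) contributes
   2 A (e / (4 A)) = e / 2, and the constant K contributes 2 A K / n *)
have d0 : 0 < e / (4 * A) by rewrite divr_gt0// mulr_gt0.
have [K K0 HK] := partial_sum_dev_le m_ge2 mu_product m_le fi cu cv d0.
exists (maxn N0.+1 (Num.Def.trunc (4 * A * K / e)).+1) => // n /= nN.
have nN0 : (N0 <= n)%N by lia.
have n0 : (0 < n)%N by lia.
have nR : 0 < n%:R :> R by rewrite ltr0n.
have nK : 4 * A * K / e <= n%:R.
  apply: (@le_trans _ _ (Num.Def.trunc (4 * A * K / e)).+1%:R).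
    by apply: ltW; exact: truncnS_gt.
  by rewrite ler_nat; lia.
have qS k : q k <= q k.+1 by exact: q_nondecreasing.
apply: (le_trans (T_mean_dev_le q_ge0 q0_gt0 qS K0 (ltW d0) HK n0)).
rewrite lecR.
have qA : q n.-1 / Qsum q n <= A / n%:R.
  have := HA n nN0; rewrite /= [X in _ <= _ * X]ger0_norm ?invr_ge0//.
  exact: le_trans (ler_norm _).
have X0 : 0 <= K + e / (4 * A) * n%:R by rewrite addr_ge0// mulr_ge0// ltW.
apply: (@le_trans _ _ (2 * (A / n%:R) * (K + e / (4 * A) * n%:R))).
  by rewrite ler_wpM2r// ler_wpM2l.
have -> : 2 * (A / n%:R) * (K + e / (4 * A) * n%:R) =
    (2 * A * K) / n%:R + e / 2.
  by field; rewrite !gt_eqF.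
suff : 2 * A * K / n%:R <= e / 2 by lra.
rewrite ler_pdivrMr//; move: nK; rewrite ler_pdivrMr//; lra.
Qed.
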